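(* The essential range of the contravariant functor $\mathcal{P}:\mathbf{SDS}\to\mathbf{OBD}$ is $\mathbf{OBD}_{\mathrm{po}}$; that is, an ordered Bratteli diagram is isomorphic in $\mathbf{OBD}$ to $\mathcal{P}(\mathcal{X})$ for some $\mathcal{X}$ in $\mathbf{SDS}$ if and only if it is properly ordered.
   Context: **Bratteli diagrams.** A Bratteli diagram $(V,E)$ consists of a vertex set $V=V_0\sqcup V_1\sqcup\cdots$ with each $V_n$ finite and non-empty and $V_0$ a singleton, and an edge set $E=E_1\sqcup E_2\sqcup\cdots$ with each $E_n$ finite and non-empty, together with maps $r,s:E\to V$ (range, source) such that $r(E_n)\subseteq V_n$, $s(E_n)\subseteq V_{n-1}$, $s^{-1}\{v\}\neq\varnothing$ for all $v\in V$ and $r^{-1}\{v\}\ne\varnothing$ for all $v\in V\setminus V_0$. An ordered Bratteli diagram $(V,E,\geq)$ is a Bratteli diagram with a partial order on $E$ such that $e,e'$ are comparable iff $r(e)=r(e')$. It is properly ordered if there is exactly one infinite path $(e_1,e_2,\ldots)$ ($e_i\in E_i$, $r(e_i)=s(e_{i+1})$) consisting of maximal edges, and exactly one consisting of minimal edges. **Edge sets.** An ordered edge set from a finite set $S$ to a finite set $T$ is a finite set $F$ with maps $s:F\to S$, $r:F\to T$ and a linear order on each $r^{-1}\{w\}$, $w\in T$. If $G$ is an ordered edge set from $T$ to $U$, then $F\circ G=\{(e,g)\in F\times G: r(e)=s(g)\}$, with source $s(e)$, range $r(g)$, and order: for $r(g)=r(g')$, $(e,g)<(e',g')$ iff $g<g'$,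 or $g=g'$ and $e<e'$. Write $F\cong F'$ if there is a bijection $F\to F'$ preserving sources, ranges and order. For $k<l$, $E_{k,l}=E_{k+1}\circ\cdots\circ E_l$; $E_{k,k}$ consists of one edge from $v$ to $v$ for each $v\in V_k$. **The category $\mathbf{OBD}$.** Objects: ordered Bratteli diagrams. An ordered premorphism $f:B=(V,E,\ge)\to C=(W,S,\ge)$ is a triple $(F,(f_n)_{n\ge0},\geq)$ where $(f_n)$ is an unbounded sequence of integers with $0=f_0\le f_1\le\cdots$, and $F=F_0\sqcup F_1\sqcup\cdots$ where each $F_n$ is a non-empty finite ordered edge set from $V_n$ to $W_{f_n}$ such that every $v\in V_n$ is the source and every $w\in W_{f_n}$ the range of some edge of $F_n$, $F_0$ is a singleton, and $E_{n+1}\circ F_{n+1}\cong F_n\circ S_{f_n,f_{n+1}}$ for all $n\ge0$. The composition of $f:B\to C$ and $g=(G,(g_n),\ge):C\to D$ is $gf=(H,(h_n),\ge)$ with $h_n=g_{f_n}$, $H_n=F_n\circ G_{f_n}$. Premorphisms $f,g:B\to C$ are equivalent if there are positive integers $n_1<m_1<n_2<m_2<\cdots$ with $f_{n_k}<g_{m_k}<f_{n_{k+1}}$ and, for all $k\ge1$, $E_{n_k,m_k}\circ G_{m_k}\cong F_{n_k}\circ S_{f_{n_k},g_{m_k}}$ and $E_{m_k,n_{k+1}}\circ F_{n_{k+1}}\cong G_{m_k}\circ S_{g_{m_k},f_{n_{k+1}}}$. Morphisms in $\mathbf{OBD}$ are equivalence classes $[f]$, with $[g][f]=[gf]$. $\mathbf{OBD}_{\mathrm{po}}$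 is the full subcategory of properly ordered Bratteli diagrams. **Objects of $\mathbf{SDS}$.** An essentially minimal totally disconnected dynamical system $(X,\varphi,x_0)$ consists of a metrizable compact totally disconnected space $X$, a homeomorphism $\varphi$ of $X$ such that $(X,\varphi)$ has a unique minimal (non-empty closed invariant) subset, and a point $x_0$ of that subset. A Kakutani–Rokhlin partition for it is a finite partition $P=\{Z(k,j): 1\le k\le K,\ 1\le j\le J(k)\}$ of $X$ into non-empty clopen sets with $\varphi(Z(k,j))=Z(k,j+1)$ for $1\le j<J(k)$, and such that the top $Z=\bigcup_kZ(k,J(k))$ contains $x_0$ and $\varphi(Z)=\bigcup_kZ(k,1)$; the sequences $(Z(k,1),\ldots,Z(k,J(k)))$ are its towers. A system of Kakutani–Rokhlin partitions is a sequence $\mathcal{R}=(P_n)_{n\ge0}$ of such partitions with $P_0=\{X\}$, $P_{n+1}$ refining $P_n$ (written $P_n\le P_{n+1}$), the tops $Z_n$ of $P_n$ ($n\ge1$) decreasing with intersection $\{x_0\}$, and $\bigcup_nP_n$ a basis for the topology of $X$. Objects of $\mathbf{SDS}$ are quadruples $(X,\varphi,x_0,\mathcal{R})$. **$\mathcal{P}$ on objects.** If $P\le Q$ are Kakutani–Rokhlin partitions and the top of $P$ contains the top of $Q$, $E(P,Q)$ is the set of triples $(S,T,k)$ with $S=(Z_1,\ldots,Z_n)$ a tower of $P$, $T=(Y_1,\ldots,Y_m)$ a tower of $Q$, $k\ge0$ an integer with $Y_{k+j}\subseteq Z_j$ for $1\le j\le n$; source $S$, range $T$, and $(S,T,k)\le(S',T',k')$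 iff $T=T'$ and $k\le k'$. For $\mathcal{R}=(P_n)$, $\mathcal{P}(X,\varphi,x_0,\mathcal{R})$ is the ordered Bratteli diagram with $V_n=\{(n,T): T\text{ a tower of }P_n\}$ and $E_n$ the copy $\{(n,S,T,k):(S,T,k)\in E(P_{n-1},P_n)\}$ of $E(P_{n-1},P_n)$ with its order. *)

(* Defs.v *)
From mathcomp Require Import all_boot all_order all_algebra.
From mathcomp Require Import boolp classical_sets reals topology.

Set Implicit Arguments.
Unset Strict Implicit.
Unset Printing Implicit Defensive.

Local Open Scope classical_set_scope.

(* [ole_comparable] says that two edges are comparable exactly when they have
   the same range, i.e. [ole] is a linear order on each fibre of [rng] and
   relates no edges of different fibres. *)
Record oedge (S T : finType) := OEdge {
  oedge_sort :> finType;
  src : oedge_sort -> S;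
  rng : oedge_sort -> T;
  ole : rel oedge_sort;
  ole_refl : reflexive ole;
  ole_anti : antisymmetric ole;
  ole_trans : transitive ole;
  ole_comparable : forall e e', (ole e e' || ole e' e) = (rng e == rng e')
}.

Definition oiso (S T : finType) (F F' : oedge S T) : Prop :=
  exists h : F -> F',
    [/\ bijective h,
        forall e, src (h e) = src e,
        forall e, rng (h e) = rng e
      & forall e e', ole (h e) (h e') = ole e e'].

Lemma ole_rng (S T : finType) (F : oedge S T) (e e' : F) :
  ole e e' -> rng e = rng e'.
Proof. by move=> ee'; apply/eqP; rewrite -ole_comparable ee'. Qed.

Section Comp.
Variables (S T U : finType) (F : oedge S T) (G : oedge T U).

Definition comp_edge : finType := {x : F * G | rng x.1 == src x.2}.

Definition comp_le (x y : comp_edge) : bool :=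
  ((val x).2 != (val y).2) && ole (val x).2 (val y).2
  || ((val x).2 == (val y).2) && ole (val x).1 (val y).1.

Lemma comp_le_refl : reflexive comp_le.
Proof. by move=> x; rewrite /comp_le eqxx !ole_refl. Qed.

Lemma comp_le_anti : antisymmetric comp_le.
Proof.
move=> [[e g] p] [[e' g'] p']; rewrite /comp_le /= => H; apply: val_inj => /=.
move: H; rewrite (eq_sym g'); have [gg|ne] /= := eqVneq g g'.
  by move=> /ole_anti ->; rewrite gg.
by rewrite !orbF => /ole_anti gg; rewrite gg eqxx in ne.
Qed.

Lemma comp_le_trans : transitive comp_le.
Proof.
move=> [[e g] p] [[e1 g1] p1] [[e2 g2] p2]; rewrite /comp_le /=.
have [->|n1] /= := eqVneq g1 g; have [E|n2] /= := eqVneq g g2.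
- exact: ole_trans.
- by [].
- by rewrite -E n1 (negPf n1) !orbF.
rewrite !orbF => l1 l2; rewrite (ole_trans l1 l2) andbT.
have [E|//] := eqVneq g1 g2.
rewrite -E in l2.
by rewrite (ole_anti (introT andP (conj l1 l2))) eqxx in n1.
Qed.

Lemma comp_le_comparable (x y : comp_edge) :
  (comp_le x y || comp_le y x) = (rng (val x).2 == rng (val y).2).
Proof.
case: x y => [[e g] p] [[e' g'] p']; rewrite /comp_le /=.
rewrite (eq_sym g'); have [gg|ne] /= := eqVneq g g'.
  by rewrite ole_comparable (eqP p) (eqP p') gg !eqxx.
by rewrite !orbF ole_comparable.
Qed.

Definition ocomp : oedge S U :=
  @OEdge S U comp_edge (fun x => src (val x).1) (fun x => rng (val x).2)
    comp_le comp_le_refl comp_le_anti comp_le_trans comp_le_comparable.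
End Comp.

(* The ordered edge set with one edge from v to v for each v in [V k]. It is
   needed as an edge set from [V k] to [V l] for [l] only propositionally equal
   to [k]; for [k <> l] it is empty. *)
Section Diag.
Variables (V : nat -> finType) (k l : nat).

Definition diag_edge : finType :=
  {x : V k * V l | Tagged V x.1 == Tagged V x.2}.

Lemma diag_inj (x y : diag_edge) : (val x).2 = (val y).2 -> x = y.
Proof.
case: x y => [[v w] p] [[v' w'] p'] /= E; apply: val_inj => /=.
have: Tagged V v == Tagged V v' by rewrite (eqP p) (eqP p') /= E.
by rewrite eq_Tagged /= E => /eqP ->.
Qed.

Lemma diag_comparable (x y : diag_edge) :
  ((x == y) || (y == x)) = ((val x).2 == (val y).2).
Proof.
by rewrite (eq_sym y) orbb; apply/eqP/eqP => [->//|/diag_inj].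
Qed.

Lemma diag_anti : antisymmetric (@eq_op diag_edge).
Proof. by move=> x y /andP[/eqP]. Qed.

Lemma diag_trans : transitive (@eq_op diag_edge).
Proof. by move=> x y z /eqP-> /eqP->. Qed.

Definition diag : oedge (V k) (V l) :=
  @OEdge (V k) (V l) diag_edge (fun x => (val x).1) (fun x => (val x).2)
    (@eq_op diag_edge) (@eqxx _) diag_anti diag_trans diag_comparable.
End Diag.

(* [edge n] is the edge set from level [n] to level [n.+1], usually written
   E_(n+1). *)
Record obd := OBD {
  vertex : nat -> finType;
  edge : forall n, oedge (vertex n) (vertex n.+1);
  vertex_gt0 : forall n, (0 < #|vertex n|)%N;
  vertex0 : #|vertex 0| = 1%N;
  edge_gt0 : forall n, (0 < #|edge n|)%N;
  src_surj : forall n (v : vertex n), exists e : edge n, src e = v;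
  rng_surj : forall n (w : vertex n.+1), exists e : edge n, rng e = w
}.

Definition is_path (B : obd) (p : forall n, edge B n) : Prop :=
  forall n, rng (p n) = src (p n.+1).

Definition max_edge (S T : finType) (F : oedge S T) (e : F) : Prop :=
  forall e' : F, ole e e' -> e' = e.

Definition min_edge (S T : finType) (F : oedge S T) (e : F) : Prop :=
  forall e' : F, ole e' e -> e' = e.

Definition properly_ordered (B : obd) : Prop :=
  (exists! p : forall n, edge B n, is_path p /\ forall n, max_edge (p n)) /\
  (exists! p : forall n, edge B n, is_path p /\ forall n, min_edge (p n)).

(* E_(k,l) for [k <= l]; empty, and never used, for [k > l]. *)
Fixpoint seg (B : obd) (k l : nat) : oedge (vertex B k) (vertex B l) :=
  match l with
  | 0 => diag (vertex B) k 0
  | l'.+1 => if (k <= l')%N then ocomp (seg B k l') (edge B l')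
             else diag (vertex B) k l'.+1
  end.

Lemma oisoI (S T : finType) (F F' : oedge S T) (h : F -> F') :
  (forall e, src (h e) = src e) -> (forall e, rng (h e) = rng e) ->
  (forall e e', ole (h e) (h e') = ole e e') ->
  (forall e', exists e, h e = e') -> oiso F F'.
Proof.
move=> hs hr ho hsurj; exists h; split=> //.
have hinj : injective h.
  move=> e e' E; apply: ole_anti.
  by rewrite -!ho E ole_refl.
have /choice[g gK] := hsurj.
by exists g => // e; apply: hinj; rewrite gK.
Qed.

Lemma oiso_refl (S T : finType) (F : oedge S T) : oiso F F.
Proof. by exists id; split=> //; exists id. Qed.

Lemma oiso_sym (S T : finType) (F F' : oedge S T) : oiso F F' -> oiso F' F.
Proof.
move=> [h [[g gK hK] hs hr ho]]; apply: (@oisoI _ _ _ _ g).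
- by move=> e; rewrite -hs hK.
- by move=> e; rewrite -hr hK.
- by move=> e e'; rewrite -ho !hK.
- by move=> e; exists (h e).
Qed.

Lemma oiso_trans (S T : finType) (F F' F'' : oedge S T) :
  oiso F F' -> oiso F' F'' -> oiso F F''.
Proof.
move=> [h [hb hs hr ho]] [h' [hb' hs' hr' ho']]; exists (h' \o h); split=> /=.
- exact: bij_comp.
- by move=> e; rewrite hs' hs.
- by move=> e; rewrite hr' hr.
- by move=> e e'; rewrite ho' ho.
Qed.

Lemma oiso_comp (S T U : finType) (F F' : oedge S T) (G G' : oedge T U) :
  oiso F F' -> oiso G G' -> oiso (ocomp F G) (ocomp F' G').
Proof.
move=> [h [[h1 hK h1K] hs hr ho]] [k [[k1 kK k1K] ks kr ko]].
have P (x : comp_edge F G) : rng (h (val x).1) == src (k (val x).2).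
  by rewrite hr ks (valP x).
apply: (@oisoI _ _ (ocomp F G) (ocomp F' G')
  (fun x => exist _ (h (val x).1, k (val x).2) (P x))) => /=.
- by move=> x; rewrite hs.
- by move=> x; rewrite kr.
- by move=> x y; rewrite /comp_le /= !(can_eq kK) !ho !ko.
- move=> [[e g] p] /=.
  have p' : rng (h1 e) == src (k1 g) by rewrite -hr -ks h1K k1K.
  by exists (exist _ (h1 e, k1 g) p'); apply: val_inj; rewrite /= h1K k1K.
Qed.

Lemma ocompA (S T U V : finType)
    (F : oedge S T) (G : oedge T U) (H : oedge U V) :
  oiso (ocomp (ocomp F G) H) (ocomp F (ocomp G H)).
Proof.
have P1 (x : comp_edge (ocomp F G) H) : rng (val (val x).1).2 == src (val x).2.
  exact: (valP x).
have P2 (x : comp_edge (ocomp F G) H) :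
  rng (val (val x).1).1 ==
    src (exist _ ((val (val x).1).2, (val x).2) (P1 x) : ocomp G H).
  exact: (valP (val x).1).
apply: (@oisoI _ _ (ocomp (ocomp F G) H) (ocomp F (ocomp G H))
  (fun x => exist _ ((val (val x).1).1,
    (exist _ ((val (val x).1).2, (val x).2) (P1 x) : ocomp G H)) (P2 x))) => //=.
- move=> [[[[e g] p] h] q] [[[[e' g'] p'] h'] q'].
  rewrite /comp_le /= /comp_le /= -!val_eqE /= !xpair_eqE.
  by case: (h == h'); case: (g == g'); rewrite /= ?orbF ?andbF ?andbT.
- move=> [[e [[g h] q]] p] /=.
  have p1 : rng e == src g := p.
  have q1 : rng (exist _ (e, g) p1 : ocomp F G) == src h := q.
  exists (exist _ ((exist _ (e, g) p1 : ocomp F G), h) q1).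
  by apply: val_inj => /=; congr (_, _); apply: val_inj.
Qed.

Lemma diagP (V : nat -> finType) k (v : V k) :
  Tagged V (v, v).1 == Tagged V (v, v).2.
Proof. exact: eqxx. Qed.

Lemma diag_eq (V : nat -> finType) k (x : diag V k k) : src x = rng x.
Proof. by have := valP x; rewrite eq_Tagged => /eqP. Qed.

Lemma ocomp_diagr (V : nat -> finType) (S : finType) k (F : oedge S (V k)) :
  oiso (ocomp F (diag V k k)) F.
Proof.
apply: (@oisoI _ _ (ocomp F (diag V k k)) F (fun x => (val x).1)) => //=.
- by move=> x; exact: (etrans (eqP (valP x)) (diag_eq _)).
- move=> [[e d] p] [[e' d'] p'] /=; rewrite /comp_le /=.
  have [//|ne /=] := eqVneq d d'; apply/negbTE/negP => /ole_rng E.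
  case/eqP: ne; apply: diag_inj.
  apply: (etrans (etrans (esym (diag_eq d)) (etrans (esym (eqP p)) E))).
  exact: (etrans (eqP p') (diag_eq d')).
- move=> e.
  have p : rng e == src (exist _ (rng e, rng e) (diagP (rng e)) : diag V k k).
    exact: eqxx.
  by exists (exist _ (e, _) p).
Qed.

Lemma ocomp_diagl (V : nat -> finType) (T : finType) k (F : oedge (V k) T) :
  oiso (ocomp (diag V k k) F) F.
Proof.
apply: (@oisoI _ _ (ocomp (diag V k k) F) F (fun x => (val x).2)) => //=.
- by move=> x; exact: (esym (etrans (diag_eq _) (eqP (valP x)))).
- move=> [[d e] p] [[d' e'] p'] /=; rewrite /comp_le /=.
  have [ee /=|ne] := eqVneq e e'; last by rewrite orbF.
  rewrite -ee ole_refl; suff -> : d = d' by rewrite eqxx.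
  apply: diag_inj.
  by apply: (etrans (eqP p)); rewrite /= ee; exact: (esym (eqP p')).
- move=> e.
  have p : rng (exist _ (src e, src e) (diagP (src e)) : diag V k k) == src e.
    exact: eqxx.
  by exists (exist _ (_, e) p).
Qed.

Lemma seg_nn (B : obd) k : seg B k k = diag (vertex B) k k.
Proof. by case: k => //= k; rewrite ltnn. Qed.

Lemma segS (B : obd) k l : (k <= l)%N ->
  seg B k l.+1 = ocomp (seg B k l) (edge B l).
Proof. by move=> /= ->. Qed.

Lemma seg_cat (B : obd) a b c : (a <= b)%N -> (b <= c)%N ->
  oiso (ocomp (seg B a b) (seg B b c)) (seg B a c).
Proof.
move=> ab; elim: c => [|c IH].
  by case: b ab => // _ _; exact: ocomp_diagr.
rewrite leq_eqVlt => /predU1P[<-|]; first by rewrite seg_nn; exact: ocomp_diagr.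
rewrite ltnS => bc; rewrite (segS _ bc) (segS _ (leq_trans ab bc)).
apply: (oiso_trans (oiso_sym (ocompA _ _ _))).
by apply: oiso_comp (IH bc) (oiso_refl _).
Qed.

Record premor (B C : obd) := Premor {
  lvl : nat -> nat;
  lvl0 : lvl 0 = 0%N;
  lvl_le : forall n, (lvl n <= lvl n.+1)%N;
  lvl_unbounded : forall m, exists n, (m <= lvl n)%N;
  pedge : forall n, oedge (vertex B n) (vertex C (lvl n));
  pedge_gt0 : forall n, (0 < #|pedge n|)%N;
  pedge_src : forall n v, exists e : pedge n, src e = v;
  pedge_rng : forall n w, exists e : pedge n, rng e = w;
  pedge0 : #|pedge 0| = 1%N;
  pedge_comm : forall n,
    oiso (ocomp (edge B n) (pedge n.+1))
         (ocomp (pedge n) (seg C (lvl n) (lvl n.+1)))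
}.

Arguments pedge_src {B C} p {n} v.
Arguments pedge_rng {B C} p {n} w.

Lemma lvl_homo (B C : obd) (f : premor B C) : {homo lvl f : m n / (m <= n)%N}.
Proof. by apply: homo_leq => //; [exact: leq_trans | exact: lvl_le]. Qed.

Section Identity.
Variable B : obd.
Let F n : oedge (vertex B n) (vertex B n) := diag (vertex B) n n.

Lemma diag_src n (v : vertex B n) : exists e : F n, src e = v.
Proof. by exists (exist _ (v, v) (diagP v)). Qed.

Lemma diag_rng n (v : vertex B n) : exists e : F n, rng e = v.
Proof. by exists (exist _ (v, v) (diagP v)). Qed.

Lemma diag_gt0 n : (0 < #|F n|)%N.
Proof.
have /card_gt0P[v _] := vertex_gt0 B n.
by have [e _] := diag_src v; apply/card_gt0P; exists e.
Qed.

Lemma diag0 : #|F 0| = 1%N.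
Proof.
apply/eqP; rewrite eqn_leq diag_gt0 andbT -(vertex0 B).
by apply: (@leq_card _ _ (@rng _ _ (F 0))) => x y; exact: diag_inj.
Qed.

Lemma diag_comm n : oiso (ocomp (edge B n) (F n.+1)) (ocomp (F n) (seg B n n.+1)).
Proof.
rewrite segS // seg_nn.
apply: (oiso_trans (ocomp_diagr _)); apply: oiso_sym.
apply: (oiso_trans (ocomp_diagl _)); exact: ocomp_diagl.
Qed.

Definition pid : premor B B :=
  @Premor B B id erefl leqnSn (fun m => ex_intro _ m (leqnn m)) F diag_gt0
    diag_src diag_rng diag0 diag_comm.
End Identity.

Section Composition.
Variables (B C D : obd) (f : premor B C) (g : premor C D).
Let h n := lvl g (lvl f n).
Let H n : oedge (vertex B n) (vertex D (h n)) :=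
  ocomp (pedge f n) (pedge g (lvl f n)).

Lemma pcomp_lvl0 : h 0 = 0%N.
Proof. by rewrite /h !lvl0. Qed.

Lemma pcomp_lvl_le n : (h n <= h n.+1)%N.
Proof. exact/lvl_homo/lvl_le. Qed.

Lemma pcomp_lvl_unbounded m : exists n, (m <= h n)%N.
Proof.
have [k mk] := lvl_unbounded g m; have [n kn] := lvl_unbounded f k.
by exists n; rewrite (leq_trans mk) //; exact: lvl_homo.
Qed.

Lemma pcomp_src n v : exists e : H n, src e = v.
Proof.
have [e ev] := pedge_src f v; have [e' e'E] := pedge_src g (rng e).
have p : rng e == src e' by rewrite e'E.
by exists (exist _ (e, e') p).
Qed.

Lemma pcomp_rng n w : exists e : H n, rng e = w.
Proof.
have [e ev] := pedge_rng g w; have [e' e'E] := pedge_rng f (src e).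
have p : rng e' == src e by rewrite e'E.
by exists (exist _ (e', e) p).
Qed.

Lemma pcomp_gt0 n : (0 < #|H n|)%N.
Proof.
have /card_gt0P[v _] := vertex_gt0 B n.
by have [e _] := pcomp_src v; apply/card_gt0P; exists e.
Qed.

Lemma pcomp0 : #|H 0| = 1%N.
Proof.
apply/eqP; rewrite eqn_leq pcomp_gt0 andbT.
have G1 : #|pedge g (lvl f 0)| = 1%N by rewrite lvl0 pedge0.
rewrite (leq_trans (max_card _)) // card_sig.
by rewrite (leq_trans (max_card _)) // card_prod pedge0 G1.
Qed.

Lemma pedge_seg k l : (k <= l)%N ->
  oiso (ocomp (seg C k l) (pedge g l))
       (ocomp (pedge g k) (seg D (lvl g k) (lvl g l))).
Proof.
elim: l => [|l IH].
  rewrite leqn0 => /eqP->; rewrite !seg_nn.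
  apply: (oiso_trans (ocomp_diagl _)); apply: oiso_sym; exact: ocomp_diagr.
rewrite leq_eqVlt => /predU1P[->|].
  rewrite !seg_nn.
  apply: (oiso_trans (ocomp_diagl _)); apply: oiso_sym; exact: ocomp_diagr.
rewrite ltnS => kl; rewrite segS //.
apply: (oiso_trans (ocompA _ _ _)).
apply: (oiso_trans (oiso_comp (oiso_refl _) (pedge_comm g l))).
apply: (oiso_trans (oiso_sym (ocompA _ _ _))).
apply: (oiso_trans (oiso_comp (IH kl) (oiso_refl _))).
apply: (oiso_trans (ocompA _ _ _)).
by apply: (oiso_comp (oiso_refl _)); apply: seg_cat; exact: lvl_homo.
Qed.

Lemma pcomp_comm n :
  oiso (ocomp (edge B n) (H n.+1)) (ocomp (H n) (seg D (h n) (h n.+1))).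
Proof.
apply: (oiso_trans (oiso_sym (ocompA _ _ _))).
apply: (oiso_trans (oiso_comp (pedge_comm f n) (oiso_refl _))).
apply: (oiso_trans (ocompA _ _ _)); apply: oiso_sym.
apply: (oiso_trans (ocompA _ _ _)); apply: oiso_sym.
by apply: (oiso_comp (oiso_refl _)); apply: pedge_seg; exact: lvl_le.
Qed.

(* [pcomp f g] is the composite usually written gf. *)
Definition pcomp : premor B D :=
  @Premor B D h pcomp_lvl0 pcomp_lvl_le pcomp_lvl_unbounded H pcomp_gt0
    pcomp_src pcomp_rng pcomp0 pcomp_comm.
End Composition.

Definition pequiv (B C : obd) (f g : premor B C) : Prop :=
  exists n m : nat -> nat, forall k,
    [/\ [/\ (0 < n k)%N, (n k < m k)%N & (m k < n k.+1)%N],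
        (lvl f (n k) < lvl g (m k))%N /\ (lvl g (m k) < lvl f (n k.+1))%N,
        oiso (ocomp (seg B (n k) (m k)) (pedge g (m k)))
             (ocomp (pedge f (n k)) (seg C (lvl f (n k)) (lvl g (m k))))
      & oiso (ocomp (seg B (m k) (n k.+1)) (pedge f (n k.+1)))
             (ocomp (pedge g (m k)) (seg C (lvl g (m k)) (lvl f (n k.+1))))].

(* A morphism of OBD is a [pequiv]-class of premorphisms, so two of them are
   equal when their representatives are [pequiv]. *)
Definition obd_iso (B C : obd) : Prop :=
  exists (f : premor B C) (g : premor C B),
    pequiv (pcomp f g) (pid B) /\ pequiv (pcomp g f) (pid C).

Definition homeo (T U : topologicalType) (f : T -> U) : Prop :=
  exists g : U -> T,
    [/\ continuous f, continuous g, cancel f g & cancel g f].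

Definition metrizable (R : realType) (T : topologicalType) : Prop :=
  exists (M : metricType R) (f : T -> M), homeo f.

Definition closed_invariant (T : topologicalType) (phi : T -> T) (A : set T) :=
  [/\ A !=set0, closed A & phi @` A = A].

Definition minimal_set (T : topologicalType) (phi : T -> T) (M : set T) :=
  closed_invariant phi M /\
  forall A, closed_invariant phi A -> A `<=` M -> A = M.

Record emds (R : realType) := EMDS {
  space :> topologicalType;
  dyn : space -> space;
  base : space;
  space_metrizable : metrizable R space;
  space_compact : compact [set: space];
  space_totally_disconnected : totally_disconnected [set: space];
  dyn_homeo : homeo dyn;
  dyn_ess_minimal : exists! M, minimal_set dyn M;
  base_minimal : forall M, minimal_set dyn M -> M base
}.

(* A partition is given by the list of its towers, a tower being the list
   (Z(k,1), ..., Z(k,J(k))) of its sets. The cells are thus indexed by pairs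
   (k, j) counted from 0. *)
Definition cell (T : Type) (ts : seq (seq (set T))) (i : nat * nat) : set T :=
  nth set0 (nth [::] ts i.1) i.2.

Definition cell_dom (T : Type) (ts : seq (seq (set T))) : set (nat * nat) :=
  [set i | (i.1 < size ts)%N /\ (i.2 < size (nth [::] ts i.1))%N].

Definition cells (T : Type) (ts : seq (seq (set T))) : set (set T) :=
  cell ts @` cell_dom ts.

Definition top (T : Type) (ts : seq (seq (set T))) : set T :=
  \bigcup_(t in [set` ts]) last set0 t.

Definition bottom (T : Type) (ts : seq (seq (set T))) : set T :=
  \bigcup_(t in [set` ts]) head set0 t.

Record krp (R : realType) (X : emds R) := KRP {
  towers : seq (seq (set X));
  tower_gt0 : forall t, t \in towers -> (0 < size t)%N;
  cell_partition : partition (cell_dom towers) (cell towers) [set: X];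
  cell_clopen : forall A, cells towers A -> clopen A;
  cell_step : forall t j, t \in towers -> (j.+1 < size t)%N ->
    @dyn R X @` nth set0 t j = nth set0 t j.+1;
  top_base : top towers (base X);
  top_bottom : @dyn R X @` top towers = bottom towers
}.

Definition refines (R : realType) (X : emds R) (P Q : krp X) : Prop :=
  forall B, cells (towers Q) B -> exists2 A, cells (towers P) A & B `<=` A.

Record sds (R : realType) := SDS {
  system :> emds R;
  part : nat -> krp system;
  part0 : towers (part 0) = [:: [:: [set: system]]];
  part_refines : forall n, refines (part n) (part n.+1);
  part_top : forall n, (1 <= n)%N ->
    top (towers (part n.+1)) `<=` top (towers (part n));
  part_top_bigcap :
    \bigcap_(n in [set n | (1 <= n)%N]) top (towers (part n)) = [set base system];
  part_basis : basis (\bigcup_n cells (towers (part n)))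
}.

Section TowerEdges.
Variables (R : realType) (X : emds R) (P Q : krp X).

Definition tower (P : krp X) : finType := seq_sub (towers P).

Definition traverses (S T : seq (set X)) (k : nat) : Prop :=
  (k + size S <= size T)%N /\
  forall j, (j < size S)%N -> nth set0 T (k + j) `<=` nth set0 S j.

(* Since towers are nonempty, [traverses S T k] forces k < size T, so that
   the bound on k below excludes no triple. *)
Definition height (P : krp X) : nat := \max_(t <- towers P) size t.

Definition tower_edge : finType :=
  {e : tower P * tower Q * 'I_(height Q)
     | `[< traverses (val e.1.1) (val e.1.2) e.2 >]}.

Definition tower_edge_le (e e' : tower_edge) : bool :=
  ((val e).1.2 == (val e').1.2) && ((val e).2 <= (val e').2)%N.

Lemma mem_cell (ts : seq (seq (set X))) (t : seq (set X)) j :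
  t \in ts -> (j < size t)%N ->
  cell_dom ts (index t ts, j) /\ cell ts (index t ts, j) = nth set0 t j.
Proof. by move=> tP jt; rewrite /cell_dom /cell /= nth_index // index_mem. Qed.

Lemma cell_mem (ts : seq (seq (set X))) A : cells ts A ->
  exists t j, [/\ t \in ts, (j < size t)%N & A = nth set0 t j].
Proof.
move=> [[k j] [/= kP jk] <-]; exists (nth [::] ts k), j; split=> //.
exact: mem_nth.
Qed.

Lemma cell_neq0 (O : krp X) t j : t \in towers O -> (j < size t)%N ->
  nth set0 t j !=set0.
Proof.
move=> tO jt; have [D <-] := mem_cell tO jt.
by case: (cell_partition O) => _ _; apply.
Qed.

Lemma cell_inj (O : krp X) t j t' j' x : t \in towers O -> (j < size t)%N ->
  t' \in towers O -> (j' < size t')%N ->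
  nth set0 t j x -> nth set0 t' j' x -> t = t' /\ j = j'.
Proof.
move=> tO jt tO' jt'.
have [D <-] := mem_cell tO jt; have [D' <-] := mem_cell tO' jt' => x1 x2.
case: (cell_partition O) => _ tr _.
have [E ->] := tr _ _ D D' (ex_intro _ x (conj x1 x2)).
by split=> //; rewrite -(nth_index [::] tO) E nth_index.
Qed.

Lemma tower_edge_refl : reflexive tower_edge_le.
Proof. by move=> e; rewrite /tower_edge_le eqxx leqnn. Qed.

Lemma tower_edge_trans : transitive tower_edge_le.
Proof.
move=> e1 e2 e3 /andP[/eqP h k] /andP[/eqP h' k'].
by rewrite /tower_edge_le h h' eqxx (leq_trans k k').
Qed.

Lemma tower_edge_anti : antisymmetric tower_edge_le.
Proof.
move=> [[[S T] k] p] [[[S' T'] k'] p'].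
rewrite /tower_edge_le /= => /andP[/andP[/eqP E kk'] /andP[_ k'k]].
have Ek : k = k' by apply: val_inj; apply/eqP; rewrite eqn_leq kk' k'k.
apply: val_inj => /=; subst T' k'.
congr (_, _, _); apply: val_inj => /=.
move/asboolP: p => /= [hS tS]; move/asboolP: p' => /= [hS' tS'].
have S0 := tower_gt0 (valP S); have S'0 := tower_gt0 (valP S').
have kT : (k + 0 < size (val T))%N by rewrite (leq_trans _ hS) // ltn_add2l.
have [x Tx] := cell_neq0 (valP T) kT.
by have [] := cell_inj (valP S) S0 (valP S') S'0 (tS _ S0 _ Tx) (tS' _ S'0 _ Tx).
Qed.

Lemma tower_edge_comparable (e e' : tower_edge) :
  (tower_edge_le e e' || tower_edge_le e' e) = ((val e).1.2 == (val e').1.2).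
Proof.
rewrite /tower_edge_le (eq_sym (val e').1.2).
by case: eqP => //= _; exact: leq_total.
Qed.

Definition E_tower : oedge (tower P) (tower Q) :=
  @OEdge (tower P) (tower Q) tower_edge
    (fun e => (val e).1.1) (fun e => (val e).1.2) tower_edge_le
    tower_edge_refl tower_edge_anti tower_edge_trans tower_edge_comparable.

Hypothesis PQ : refines P Q.
Hypothesis topPQ : top (towers Q) `<=` top (towers P).

Lemma top_last (O : krp X) t j x : t \in towers O -> (j < size t)%N ->
  nth set0 t j x -> top (towers O) x -> j.+1 = size t.
Proof.
move=> tO jt tx [t' tO' x']; have t'0 := tower_gt0 tO'.
have jt' : ((size t').-1 < size t')%N by rewrite ltn_predL.
rewrite -nth_last in x'.
have [-> ->] := cell_inj tO jt tO' jt' tx x'.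
by rewrite prednK.
Qed.

Lemma bottom_head (O : krp X) t j x : t \in towers O -> (j < size t)%N ->
  nth set0 t j x -> bottom (towers O) x -> j = 0%N.
Proof.
move=> tO jt tx [t' tO' x']; have t'0 := tower_gt0 tO'.
rewrite -nth0 in x'.
by have [] := cell_inj tO jt tO' t'0 tx x'.
Qed.

Lemma traversesI S T k : S \in towers P -> T \in towers Q ->
  (k < size T)%N -> nth set0 T k `<=` nth set0 S 0 -> traverses S T k.
Proof.
move=> SP TQ kT kS.
suff H j : (j < size S)%N ->
    (k + j < size T)%N /\ nth set0 T (k + j) `<=` nth set0 S j.
  split=> [|j /H[]//].
  have S0 := tower_gt0 SP; have jS : ((size S).-1 < size S)%N by rewrite ltn_predL.
  by have [+ _] := H _ jS; rewrite -addnS prednK.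
elim: j => [_|j IH jS]; first by rewrite addn0.
have [kj sub] := IH (ltnW jS).
have kj1 : (k + j.+1 < size T)%N.
  rewrite addnS ltn_neqAle kj andbT; apply/negP => /eqP E.
  have [x Tx] := cell_neq0 TQ kj.
  have : top (towers Q) x.
    by exists T => //; rewrite -nth_last -E.
  move=> /topPQ /(top_last SP (ltnW jS) (sub _ Tx)) E'.
  by rewrite E' ltnn in jS.
split=> //; rewrite addnS in kj1 *.
by rewrite -(cell_step TQ kj1) -(cell_step SP jS); exact: image_subset.
Qed.

Lemma height_gt T k : T \in towers Q -> (k < size T)%N -> (k < height Q)%N.
Proof. by move=> TQ kT; apply: (leq_trans kT); exact: leq_bigmax_seq. Qed.

Lemma E_towerI (S : tower P) (T : tower Q) k : (k < size (val T))%N ->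
  nth set0 (val T) k `<=` nth set0 (val S) 0 ->
  exists e : E_tower, src e = S /\ rng e = T.
Proof.
move=> kT kS; have H := traversesI (valP S) (valP T) kT kS.
have kh := height_gt (valP T) kT.
have p : `[< traverses (val (S, T, Ordinal kh).1.1) (val (S, T, Ordinal kh).1.2)
             (S, T, Ordinal kh).2 >] by apply/asboolP.
by exists (exist _ (S, T, Ordinal kh) p).
Qed.

Lemma cells_cover (O : krp X) x : exists t j,
  [/\ t \in towers O, (j < size t)%N & nth set0 t j x].
Proof.
have [cov _ _] := cell_partition O.
have [i Di xi] : cover (cell_dom (towers O)) (cell (towers O)) x by rewrite cov.
have [|t [j [tO jt E]]] := @cell_mem (towers O) (cell (towers O) i).
  by exists i.
by exists t, j; split=> //; rewrite -E.
Qed.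

Lemma refines_cell T k : T \in towers Q -> (k < size T)%N ->
  exists S j, [/\ S \in towers P, (j < size S)%N
                & nth set0 T k `<=` nth set0 S j].
Proof.
move=> TQ kT; have [D E] := mem_cell TQ kT.
have [|A /cell_mem[S [j [SP jS ->]]] sub] := @PQ (nth set0 T k).
  by exists (index T (towers Q), k).
by exists S, j.
Qed.

Lemma E_tower_src (S : tower P) : exists e : E_tower, src e = S.
Proof.
have S0 := tower_gt0 (valP S); have [x Sx] := cell_neq0 (valP S) S0.
have [T [k [TQ kT Tx]]] := cells_cover Q x.
have [S' [j [SP' jS' sub]]] := refines_cell TQ kT.
have [E0 Ej] := cell_inj (valP S) S0 SP' jS' Sx (sub _ Tx).
rewrite -E0 -Ej in sub.
by have [e [? _]] := @E_towerI S (SeqSub TQ) k kT sub; exists e.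
Qed.

Lemma E_tower_rng (T : tower Q) : exists e : E_tower, rng e = T.
Proof.
have T0 := tower_gt0 (valP T); have [x Tx] := cell_neq0 (valP T) T0.
have [S [j [SP jS sub]]] := refines_cell (valP T) T0.
have : bottom (towers Q) x by exists (val T); rewrite -?nth0 //; exact: valP.
rewrite -top_bottom => -[y /topPQ yP yx].
have : bottom (towers P) x by rewrite -top_bottom; exists y.
move=> /(bottom_head SP jS (sub _ Tx)) j0; rewrite j0 in sub.
by have [e [_ ?]] := @E_towerI (SeqSub SP) T 0 T0 sub; exists e.
Qed.
End TowerEdges.

Section Functor.
Variables (R : realType) (X : sds R).
Let V n : finType := tower (part X n).
Let E n : oedge (V n) (V n.+1) := E_tower (part X n) (part X n.+1).

Lemma part_topS n : top (towers (part X n.+1)) `<=` top (towers (part X n)).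
Proof.
case: n => [x _|n]; last exact: part_top.
by exists [:: setT]; rewrite ?part0 //= inE.
Qed.

Lemma tower_card_gt0 n : (0 < #|V n|)%N.
Proof.
have [t [j [tP _ _]]] := cells_cover (part X n) (base X).
by apply/card_gt0P; exists (SeqSub tP).
Qed.

Lemma tower_card0 : #|V 0| = 1%N.
Proof. by rewrite /V /tower part0 card_seq_sub. Qed.

Lemma E_tower_srcS n (v : V n) : exists e : E n, src e = v.
Proof. exact: E_tower_src (@part_refines R X n) (@part_topS n) v. Qed.

Lemma E_tower_rngS n (w : V n.+1) : exists e : E n, rng e = w.
Proof. exact: E_tower_rng (@part_refines R X n) (@part_topS n) w. Qed.

Lemma E_tower_gt0 n : (0 < #|E n|)%N.
Proof.
have /card_gt0P[v _] := tower_card_gt0 n.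
by have [e _] := E_tower_srcS v; apply/card_gt0P; exists e.
Qed.

Definition P_obj : obd :=
  @OBD V E tower_card_gt0 tower_card0 E_tower_gt0 E_tower_srcS E_tower_rngS.
End Functor.

(* Main.v *)
Require Import Defs.
From HB Require Import structures.
From mathcomp Require Import all_boot all_order all_algebra.
From mathcomp Require Import boolp classical_sets filter reals topology.

(* Call B eventually constant if for every n there is m >= n such that all
   maximal edges of E_(n,m) have the same source. This forces a unique infinite
   maximal path, and it passes from C to B along an isomorphism, since E_(n,m)
   is, up to isomorphism, F_n followed by a segment of C followed by something
   else. In P(X) a maximal edge from S to T has the top of T inside the top of
   S, and by compactness the tops of a late partition all lie inside the cell of
   x_0; bottoms are handled in the same way with the image of x_0.

   Conversely, let X be the space of infinite paths of a properly ordered B. The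
   graph of the Vershik map consists of the pairs (x, y) such that, for each n,
   the truncations to level n are consecutive in the order, or that of x is
   maximal and that of y minimal. This condition passes from level n+1 to level
   n and is symmetric under reversal of the order, so compactness gives
   existence of y, while proper ordering gives uniqueness and continuity. The
   tower of a vertex v lists the cylinders of the finite paths ending at v, and
   an edge e corresponds to the position of its minimal extension downwards in
   the tower of its range. *)

Set Implicit Arguments.
Unset Strict Implicit.
Unset Printing Implicit Defensive.

Import Order.TTheory GRing.Theory Num.Theory.

Local Open Scope classical_set_scope.

(** * Extremal and consecutive edges *)

Lemma dependent_choice (I : Type) (T : I -> Type) (P : forall i, T i -> Prop) :
  (forall i, exists t, P i t) -> exists f, forall i, P i (f i).
Proof. by move=> H; exists (fun i => sval (cid (H i))) => i; exact: svalP. Qed.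

Section Extremal.
Variables (S T : finType) (F : oedge S T).
Implicit Types (b : bool) (x y z : F).

(* The boolean selects the order or its dual, so that one proof serves the
   maximal and the minimal edges. *)
Definition dle b x y : bool := if b then ole x y else ole y x.

Definition ext b x : Prop := forall y, dle b x y -> y = x.

Definition cov b x y : Prop :=
  [/\ dle b x y, x <> y & forall z, dle b x z -> dle b z y -> z = x \/ z = y].

(* The relation that the Vershik map induces on the paths of a given length. *)
Definition vadj b x y : Prop := cov b x y \/ ext b x /\ ext (~~ b) y.

Lemma dleN b x y : dle (~~ b) x y = dle b y x.
Proof. by case: b. Qed.

Lemma dle_refl b x : dle b x x.
Proof. by case: b; exact: ole_refl. Qed.

Lemma dle_anti b x y : dle b x y -> dle b y x -> x = y.
Proof. by case: b => /= xy yx; apply: ole_anti; rewrite xy yx. Qed.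

Lemma dle_trans b x y z : dle b x y -> dle b y z -> dle b x z.
Proof. by case: b => /= xy yz; [exact: ole_trans xy yz | exact: ole_trans yz xy]. Qed.

Lemma dle_rng b x y : dle b x y -> rng x = rng y.
Proof. by case: b => /ole_rng. Qed.

Lemma dle_total b x y : rng x = rng y -> dle b x y \/ dle b y x.
Proof.
move=> E; have := ole_comparable x y; rewrite E eqxx.
by case: b => /= /orP[]; [left|right|right|left].
Qed.

(** Induction on the number of edges above [x] in the chosen order: a strictly larger edge has fewer
    above it. *)
Lemma ext_exists b x : exists2 y, dle b x y & ext b y.
Proof.
have [n] := ubnP #|[pred y | dle b x y]|; elim: n x => // n IH x le.
have [?|/existsNP[y /not_implyP[xy /eqP nyx]]] := pselect (ext b x).
  by exists x => //; exact: dle_refl.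
have [|z yz ze] := IH y; last by exists z => //; exact: dle_trans xy yz.
rewrite ltnS in le; apply: leq_trans le; apply: proper_card.
apply/properP; split; first by apply/fintype.subsetP => z; exact: dle_trans.
exists x; rewrite !inE ?dle_refl //; apply/negP => yx.
by rewrite (dle_anti xy yx) eqxx in nyx.
Qed.

Lemma ext_uniq b x y : ext b x -> ext b y -> rng x = rng y -> x = y.
Proof. by move=> ex ey /(dle_total b)[/ex|/ey]. Qed.

Lemma covN b x y : cov (~~ b) x y <-> cov b y x.
Proof.
rewrite /cov !dleN; split=> -[xy ne H]; split=> //; try exact/nesym; move=> z h1 h2.
- by rewrite or_comm; apply: H; rewrite dleN.
- by rewrite dleN in h1; rewrite dleN in h2; rewrite or_comm; exact: H.
Qed.

Lemma vadjN b x y : vadj (~~ b) x y <-> vadj b y x.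
Proof. by rewrite /vadj covN negbK (and_comm (ext (~~ b) x)). Qed.

Lemma cov_uniq b x y z : cov b x y -> cov b x z -> y = z.
Proof.
move=> [xy nxy Hy] [xz nxz Hz].
have [||] := @dle_total b y z; first by rewrite -(dle_rng xy) (dle_rng xz).
  by move=> /(Hz _ xy)[E|//]; case: nxy.
by move=> /(Hy _ xz)[E|//]; case: nxz.
Qed.

(** Any edge strictly above [x] is lowered until nothing lies strictly between; the interval between
    them shrinks at each step. *)
Lemma cov_exists b x : ~ ext b x -> exists y, cov b x y.
Proof.
move=> /existsNP[y /not_implyP[xy nyx]].
have [n] := ubnP #|[pred z | dle b x z && dle b z y]|.
elim: n y xy nyx => // n IH y xy nyx le.
have [?|nc] := pselect (cov b x y); first by exists y.
have [z [xz zy nzx nzy]] : exists z, [/\ dle b x z, dle b z y, z <> x & z <> y].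
  apply: contrapT => nz; apply: nc; split=> // [|z xz zy]; first exact/nesym.
  by apply: contrapT => /not_orP[? ?]; apply: nz; exists z.
apply: (IH z) => //; rewrite ltnS in le; apply: leq_trans le.
apply: proper_card; apply/properP; split.
  apply/fintype.subsetP => u; rewrite !inE => /andP[-> uz] /=; exact: dle_trans uz zy.
exists y; rewrite !inE ?xy ?dle_refl //=.
by apply/negP => yz; apply: nzy; exact: dle_anti zy yz.
Qed.

Lemma vadj_exists b x : exists y, vadj b x y.
Proof.
have [ex|/cov_exists[y]] := pselect (ext b x); last by exists y; left.
by have [y _ ey] := ext_exists (~~ b) x; exists y; right.
Qed.

Lemma vadj_next b x y : vadj b x y -> ~ ext b x -> cov b x y.
Proof. by move=> [|[]]. Qed.

Lemma vadj_ext b x y : vadj b x y -> ext b x -> ext (~~ b) y.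
Proof. by move=> [[xy nxy _] /(_ _ xy)/esym|[]]. Qed.

End Extremal.

(** * Extremal and consecutive edges of a composite *)

Section ExtremalComp.
Variables (S T U : finType) (F : oedge S T) (G : oedge T U).
Implicit Types (b : bool) (x y : ocomp F G).

(** Reversing the order of both factors reverses the composite, so one lexicographic formula serves
    both values of [b]. *)
Lemma dle_comp b x y : dle b x y =
  ((val x).2 != (val y).2) && dle b (val x).2 (val y).2
  || ((val x).2 == (val y).2) && dle b (val x).1 (val y).1.
Proof.
by case: b; rewrite /= /comp_le // (eq_sym (val x).2).
Qed.

Lemma ext_comp1 b x : ext b x -> ext b (val x).1.
Proof.
move=> ex e' le; have p : rng e' == src (val x).2.
  by rewrite -(dle_rng le); exact: valP x.
have /ex <- // : dle b x (exist _ (e', (val x).2) p : ocomp F G).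
by rewrite dle_comp /= eqxx.
Qed.

Lemma ext_comp b x : ext b (val x).1 -> ext b (val x).2 -> ext b x.
Proof.
move=> e1 e2 y; rewrite dle_comp => /orP[/andP[ne /e2 E]|/andP[/eqP E /e1 E']].
  by rewrite E eqxx in ne.
by apply: val_inj; move: E E'; case: (val x) (val y) => [? ?] [? ?] /= -> ->.
Qed.

Hypothesis F_rng : forall w, exists e : F, rng e = w.

(** A larger second component completes to a larger composite, because [F_rng] supplies a first
    component ending at its source. *)
Lemma ext_comp2 b x : ext b x -> ext b (val x).2.
Proof.
move=> ex g le; apply: contrapT => ne; have [e /eqP p] := F_rng (src g).
have : dle b x (exist _ (e, g) p : ocomp F G).
  rewrite dle_comp /= le andbT orbC; apply/orP; right; apply/eqP => E; exact: ne.
by move/ex => E; apply: ne; rewrite -E.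
Qed.

(** The carry rule of an odometer: either the second component stays and the first advances, or the
    second advances, and then the first passes from the end of one fibre to the beginning of another
    or the same. *)
Lemma cov_comp b x y : cov b x y -> vadj b (val x).1 (val y).1.
Proof.
move=> [xy nxy H]; move: (xy); rewrite dle_comp.
move=> /orP[/andP[ne le]|/andP[/eqP E le]].
  right; split=> z.
    move=> xz; have p : rng z == src (val x).2.
      by rewrite -(dle_rng xz); exact: valP x.
    have [||E|E] := H (exist _ (z, (val x).2) p).
    - by rewrite dle_comp /= eqxx.
    - by rewrite dle_comp /= ne le.
    - by rewrite -E.
    - by rewrite -E /= eqxx in ne.
  rewrite dleN => zy; have p : rng z == src (val y).2.
    by rewrite (dle_rng zy); exact: valP y.
  have [||E|E] := H (exist _ (z, (val y).2) p).
  - by rewrite dle_comp /= ne le.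
  - by rewrite dle_comp /= eqxx.
  - by rewrite -E /= eqxx in ne.
  - by rewrite -E.
left; split=> // [E'|z xz zy].
  by apply: nxy; apply: val_inj; move: E E'; case: (val x) (val y) => [? ?] [? ?] /= -> ->.
have p : rng z == src (val x).2.
  by rewrite -(dle_rng xz); exact: valP x.
have [||E'|E'] := H (exist _ (z, (val x).2) p).
- by rewrite dle_comp /= eqxx.
- by rewrite dle_comp /= E eqxx.
- by left; rewrite -E'.
- by right; rewrite -E'.
Qed.

Lemma vadj_comp b x y : vadj b x y -> vadj b (val x).1 (val y).1.
Proof. by move=> [/cov_comp//|[/ext_comp1 ? /ext_comp1 ?]]; right. Qed.

End ExtremalComp.

Lemma oiso_dle (S T : finType) (F F' : oedge S T) (h : F -> F') b :
  (forall e e', ole (h e) (h e') = ole e e') ->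
  forall e e', dle b (h e) (h e') = dle b e e'.
Proof. by move=> ho e e'; case: b => /=. Qed.

(** * Eventually constant diagrams *)

Section ConstSrc.
Variable b : bool.

Definition const_src (S T : finType) (F : oedge S T) : Prop :=
  forall e e' : F, ext b e -> ext b e' -> src e = src e'.

Lemma ext_oiso (S T : finType) (F F' : oedge S T) : oiso F F' ->
  forall e : F, ext b e ->
    exists e' : F', [/\ ext b e', src e' = src e & rng e' = rng e].
Proof.
move=> [h [[g gK hK] hs hr ho]] e ee; exists (h e); split=> // y.
by rewrite -(hK y) (oiso_dle _ ho) => /ee ->.
Qed.

Lemma const_src_oiso (S T : finType) (F F' : oedge S T) :
  oiso F F' -> const_src F' -> const_src F.
Proof.
move=> i c e1 e2 /(ext_oiso i)[e1' [? <- _]] /(ext_oiso i)[e2' [? <- _]].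
exact: c.
Qed.

Lemma const_src_comp1 (S T U : finType) (F : oedge S T) (G : oedge T U) :
  const_src F -> const_src (ocomp F G).
Proof. by move=> c x y /ext_comp1 ? /ext_comp1 ?; exact: c. Qed.

(** The first components of two extremal composites end at the common source of the second ones, and
    a fibre has only one extremal edge. *)
Lemma const_src_comp2 (S T U : finType) (F : oedge S T) (G : oedge T U) :
  (forall w, exists e : F, rng e = w) -> const_src G -> const_src (ocomp F G).
Proof.
move=> Fr c x y ex ey /=; congr src.
apply: (ext_uniq (ext_comp1 ex) (ext_comp1 ey)).
rewrite (eqP (valP x)) (eqP (valP y)).
by apply: c; exact: ext_comp2.
Qed.

End ConstSrc.

Section Eventually.
Variable b : bool.

Definition eventually_const (B : obd) : Prop :=
  forall n, exists2 m, (n <= m)%N & const_src b (seg B n m).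

Lemma seg_rng (B : obd) k l : (k <= l)%N -> forall w, exists e : seg B k l, rng e = w.
Proof.
elim: l => [|l IH].
  by rewrite leqn0 => /eqP-> w; exists (exist _ (w, w) (diagP w)).
rewrite leq_eqVlt => /predU1P[->|].
  by rewrite seg_nn => w; exists (exist _ (w, w) (diagP w)).
rewrite ltnS => kl; rewrite segS // => w.
have [e ew] := rng_surj w; have [d dE] := IH kl (src e).
have p : rng d == src e by rewrite dE.
by exists (exist _ (d, e) p).
Qed.

Lemma seg_ext (B : obd) k l w : (k <= l)%N ->
  exists2 e : seg B k l, ext b e & rng e = w.
Proof.
move=> kl; have [e <-] := seg_rng kl w; have [e' le ee'] := ext_exists b e.
by exists e'; rewrite // (dle_rng le).
Qed.

Lemma seg1 (B : obd) k : oiso (seg B k k.+1) (edge B k).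
Proof. by rewrite segS // seg_nn; exact: ocomp_diagl. Qed.

Lemma const_src_segr (B : obd) n m m' : (n <= m)%N -> (m <= m')%N ->
  const_src b (seg B n m) -> const_src b (seg B n m').
Proof.
move=> nm mm' c; apply: const_src_oiso (oiso_sym (seg_cat B nm mm')) _.
exact: const_src_comp1.
Qed.

(** The equivalence with the identity writes E_(n_k,m_k) as an edge set of [f] followed by others.
    Moving E_(n,n_k) past the edge set of [f] exposes a segment of [C], long enough to have a
    constant source once [k] is large. *)
Lemma eventually_const_iso (B C : obd) :
  obd_iso B C -> eventually_const C -> eventually_const B.
Proof.
move=> [f [g [[nn [mm H]] _]]] cC n.
have [M fM cM] := cC (lvl f n); have [n' Mn'] := lvl_unbounded f M.
have nnS j : (nn j < nn j.+1)%N by have [[_ h1 h2] _ _ _] := H j; exact: ltn_trans h1 h2.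
have lenn j : (j <= nn j)%N.
  by elim: j => // j IH; exact: leq_ltn_trans IH (nnS j).
(* Since [j <= nn j], this index puts the level [nn k] beyond both [n] and [n']. *)
pose k := maxn n n'.
have nk : (n <= nn k)%N by apply: leq_trans (lenn k); exact: leq_maxl.
have n'k : (n' <= nn k)%N by apply: leq_trans (lenn k); exact: leq_maxr.
have [[_ /ltnW nm _] _ I _] := H k; exists (mm k); first exact: leq_trans nk nm.
apply: const_src_oiso (oiso_sym (seg_cat B nk nm)) _.
have {}I : oiso (seg B (nn k) (mm k))
    (ocomp (pedge f (nn k)) (ocomp (pedge g (lvl f (nn k)))
      (seg B (lvl (Defs.pcomp f g) (nn k)) (mm k)))).
  apply: oiso_trans (oiso_sym (ocomp_diagr _)) _.
  by apply: oiso_trans I _; exact: ocompA.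
apply: const_src_oiso (oiso_comp (oiso_refl _) I) _.
apply: const_src_oiso (oiso_sym (ocompA _ _ _)) _; apply: const_src_comp1.
apply: const_src_oiso (pedge_seg f nk) _; apply: const_src_comp2; first exact: pedge_rng.
apply: const_src_segr (cM) => //; apply: leq_trans Mn' _; exact: lvl_homo.
Qed.

Lemma ext_path_seg (B : obd) (p : forall n, edge B n) : is_path p ->
  (forall n, ext b (p n)) -> forall n m, (n <= m)%N ->
  exists e : seg B n m, [/\ ext b e, src e = src (p n) & rng e = src (p m)].
Proof.
move=> pP pe n; elim=> [|m IH].
  rewrite leqn0 => /eqP->; exists (exist _ (_, _) (diagP (src (p 0)))); split=> //.
  by move=> y; case: b => /= /eqP.
rewrite leq_eqVlt => /predU1P[->|].
  rewrite seg_nn; exists (exist _ (_, _) (diagP (src (p m.+1)))); split=> //.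
  by move=> y; case: b => /= /eqP.
rewrite ltnS => nm; have [e [ee es er]] := IH nm; rewrite segS //.
move/eqP: er => er; exists (exist _ (e, p m) er); split=> //=.
exact: ext_comp.
Qed.

(** The common source [c n] of all long extremal segments from level [n] is the only vertex of that
    level on an extremal path; the extremal edges into the [c n.+1] fit together. *)
Lemma eventually_const_path (B : obd) : eventually_const B ->
  exists! p : forall n, edge B n, is_path p /\ forall n, ext b (p n).
Proof.
move=> cB.
have /dependent_choice[c cP] (n : nat) : exists v : vertex B n, exists2 m, (n <= m)%N &
    forall m', (m <= m')%N -> forall e : seg B n m', ext b e -> src e = v.
  have [m nm cm] := cB n; have /card_gt0P[w _] := vertex_gt0 B m.
  have [e ee _] := seg_ext w nm; exists (src e), m => // m' mm' e' ee'.
  have cm' := const_src_segr nm mm' cm.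
  have /card_gt0P[w' _] := vertex_gt0 B m'.
  have [x xe _] := seg_ext w' (leq_trans nm mm'); rewrite (cm' _ _ ee' xe).
  have [[y z] [ye ys _]] := ext_oiso (oiso_sym (seg_cat B nm mm')) xe.
  by rewrite -ys; apply: cm => //; exact: ext_comp1 ye.
have pcP (p : forall n, edge B n) : is_path p -> (forall n, ext b (p n)) ->
    forall n, src (p n) = c n.
  move=> pP pe n; have [m nm H] := cP n.
  by have [e [ee <- _]] := ext_path_seg pP pe nm; exact: H ee.
have /dependent_choice[/= q qP] (n : nat) :
    exists e : edge B n, ext b e /\ rng e = c n.+1.
  have [e eE] := rng_surj (c n.+1); have [e' le ee'] := ext_exists b e.
  by exists e'; rewrite -(dle_rng le).
(* Prolonging [q n] by a long extremal segment out of [c n.+1] gives a long extremal segment from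
   level [n], whose source is [c n]. *)
have qs n : src (q n) = c n.
  have [m nm H] := cP n; have [qe qr] := qP n.
  have [m' nm' H'] := cP n.+1; pose M := maxn m m'.
  have nM : (n.+1 <= M)%N by rewrite (leq_trans nm') // leq_maxr.
  have /card_gt0P[w _] := vertex_gt0 B M; have [e ee er] := seg_ext w nM.
  have se := H' _ (leq_maxr m m') _ ee.
  have [q' [q'e q's q'r]] := ext_oiso (oiso_sym (seg1 B n)) qe.
  have p : rng q' == src e by rewrite q'r qr se.
  have /(ext_oiso (seg_cat B (leqnSn n) nM))[x [xe xs _]] :
      ext b (exist _ (q', e) p : ocomp (seg B n n.+1) (seg B n.+1 M)).
    exact: ext_comp.
  by rewrite -(H _ (leq_maxl m m') _ xe) xs /= q's.
exists q; split.
  by split=> n; have [? qr] := qP n; rewrite // qr qs.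
move=> p [pP pe]; apply: functional_extensionality_dep => n.
have [qe qr] := qP n; apply: ext_uniq qe (pe n) _.
by rewrite qr pP pcP.
Qed.

End Eventually.

(** * The diagrams of dynamical systems *)

(** Otherwise the sets [Z n] minus [O] generate a proper filter, and its cluster point lies in every
    [Z n] but not in [O]. *)
Lemma compact_nested_sub (T : topologicalType) (Z : nat -> set T) (O : set T) :
  compact [set: T] -> (forall n, closed (Z n)) ->
  (forall n, Z n.+1 `<=` Z n) -> open O -> \bigcap_n Z n `<=` O ->
  exists n, Z n `<=` O.
Proof.
move=> cT cZ dZ oO ZO; apply: contrapT => /forallNP nZO.
have ne n : (Z n `\` O) !=set0.
  apply: contrapT => /set0P/negP/negPn/eqP E; apply: (nZO n) => x Zx.
  by apply: contrapT => Ox; have : (Z n `\` O) x by []; rewrite E.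
have dZn n k : (n <= k)%N -> Z k `<=` Z n.
  elim: k => [|k IH]; first by rewrite leqn0 => /eqP->.
  by rewrite leq_eqVlt => /predU1P[->//|/IH ?]; apply: subset_trans (dZ _) _.
have FF : ProperFilter (filter_from setT (fun n => Z n `\` O)).
  apply: filter_from_proper => //; apply: filter_from_filter; first by exists 0.
  move=> i j _ _; exists (maxn i j) => // x [Zx Ox].
  by split; split=> //; apply: dZn Zx; [exact: leq_maxl | exact: leq_maxr].
have [|p [_ clp]] := cT _ FF; first by exists 0.
have pZ n : Z n p.
  apply: (cZ n) => B Bp; apply: clp Bp; exists n => // x [].
have Op : ~ O p.
  have cO : closed (~` O) by exact: open_closedC.
  by apply: cO => B Bp; apply: clp Bp; exists 0 => // x [].
by apply: Op; apply: ZO => n _; exact: pZ.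
Qed.

Section TowerEdgesExt.
Variables (R : realType) (X : emds R) (P Q : krp X).
Hypothesis PQ : refines P Q.
Hypothesis topPQ : top (towers Q) `<=` top (towers P).

Lemma bottom_mono : bottom (towers Q) `<=` bottom (towers P).
Proof. by rewrite -!top_bottom; exact: image_subset. Qed.

Definition end_cell (b : bool) (t : seq (set X)) : set X :=
  if b then last set0 t else head set0 t.

Definition ends b (O : krp X) : set X :=
  if b then top (towers O) else bottom (towers O).

Lemma E_tower_at (S : tower P) (T : tower Q) k : (k < size (val T))%N ->
  nth set0 (val T) k `<=` nth set0 (val S) 0 ->
  exists e : E_tower P Q, [/\ src e = S, rng e = T & (val e).2 = k :> nat].
Proof.
move=> kT kS; have H := traversesI topPQ (valP S) (valP T) kT kS.
have p : `[< traverses (val S) (val T) (Ordinal (height_gt (valP T) kT)) >].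
  exact/asboolP.
by exists (exist _ (S, T, _) p).
Qed.

(** A maximal traversal ends at the top of its range: otherwise [dyn] carries the top of [S] into
    the bottom of [P], where a later traversal starts. A minimal one starts at position 0, since
    bottoms of [Q] lie in bottoms of [P]. *)
Lemma ext_E_tower b (e : E_tower P Q) : ext b e ->
  end_cell b (val (rng e)) `<=` end_cell b (val (src e)).
Proof.
move: e => [[[S T] k] p] ee; have := p => /asboolP /= [le sub].
have S0 := tower_gt0 (valP S); have T0 := tower_gt0 (valP T).
case: b ee => ee /=.
  have jS : ((size (val S)).-1 < size (val S))%N by rewrite ltn_predL.
  have kj : (k + (size (val S)).-1 < size (val T))%N.
    by rewrite -ltnS -addnS prednK.
  have [x Tx] := cell_neq0 (valP T) kj; have Sx := sub _ jS _ Tx.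
  move: le; rewrite leq_eqVlt => /predU1P[E|lt].
    by rewrite -!nth_last -E -subn1 -addnBA // subn1; exact: sub.
  (* The cell of [T] just after the traversal meets the bottom of [P], so it lies in the first cell
     of some tower. *)
  have kj1 : ((k + (size (val S)).-1).+1 < size (val T))%N.
    by rewrite -addnS prednK.
  have Tfx : nth set0 (val T) (k + size (val S)) (dyn x).
    by rewrite -(prednK S0) addnS -(cell_step (valP T) kj1); exists x.
  have [S' [j [SP jS' sub']]] := refines_cell PQ (valP T) lt.
  have j0 : j = 0.
    apply: (bottom_head SP jS' (sub' _ Tfx)).
    rewrite -top_bottom; exists x => //; exists (val S); first exact: valP.
    by rewrite -nth_last.
  rewrite j0 in sub'.
  have [e' [ES ET Ek]] := E_tower_at (S := SeqSub SP) lt sub'.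
  have Ee : e' = exist _ (S, T, k) p.
    apply: ee; rewrite /dle /= /tower_edge_le -[(val e').1.2]/(rng e') ET eqxx Ek.
    exact: leq_addr.
  (* The later edge equals the given maximal one, which would force [size (val S)] to be 0. *)
  move: Ek; rewrite Ee /= -[LHS]addn0 => /addnI E.
  by rewrite -E in S0.
have [x Tx] := cell_neq0 (valP T) T0.
have [S' [j [SP jS' sub']]] := refines_cell PQ (valP T) T0.
have j0 : j = 0.
  apply: (bottom_head SP jS' (sub' _ Tx)); apply: bottom_mono.
  by exists (val T); [exact: valP | rewrite -nth0].
rewrite j0 in sub'.
have [e' [ES ET Ek]] := E_tower_at (S := SeqSub SP) T0 sub'.
have Ee : e' = exist _ (S, T, k) p.
  by apply: ee; rewrite /dle /= /tower_edge_le -[(val e').1.2]/(rng e') ET eqxx Ek.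
have k0 : k = 0 :> nat by rewrite -Ek Ee.
by have := sub _ S0; rewrite k0 !nth0.
Qed.

End TowerEdgesExt.

Section Ends.
Variables (R : realType) (X : emds R) (b : bool).

Lemma end_cell_idx (t : seq (set X)) :
  end_cell b t = nth set0 t (if b then (size t).-1 else 0).
Proof. by rewrite /end_cell; case: b; rewrite ?nth_last ?nth0. Qed.

Lemma end_idx_lt (O : krp X) (t : seq (set X)) :
  t \in towers O -> ((if b then (size t).-1 else 0) < size t)%N.
Proof. by move=> /tower_gt0; case: b => // ?; rewrite ltn_predL. Qed.

Lemma end_cell_clopen (O : krp X) t : t \in towers O -> clopen (end_cell b t).
Proof.
move=> tO; have [D E] := mem_cell tO (end_idx_lt tO).
apply: (@cell_clopen _ _ O); rewrite end_cell_idx -E.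
by exists (index t (towers O), if b then (size t).-1 else 0).
Qed.

Lemma ends_clopen (O : krp X) : clopen (ends b O).
Proof.
have -> : ends b O = \bigcup_(t in [set` towers O]) end_cell b t.
  by rewrite /ends; case: b.
split; first by apply: bigcup_open => t /= /end_cell_clopen[].
by rewrite bigcup_seq; apply: closed_bigsetU => t /= /end_cell_clopen[].
Qed.

Lemma endsP (O : krp X) x :
  ends b O x <-> exists2 t, t \in towers O & end_cell b t x.
Proof. by rewrite /ends; case: b; split=> -[t ? ?]; exists t. Qed.

Lemma end_cell_inj (O : krp X) t t' x : t \in towers O -> t' \in towers O ->
  end_cell b t x -> end_cell b t' x -> t = t'.
Proof.
move=> tO tO'; rewrite !end_cell_idx => tx tx'.
by have [] := cell_inj tO (end_idx_lt tO) tO' (end_idx_lt tO') tx tx'.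
Qed.

Lemma end_cell_neq0 (O : krp X) t : t \in towers O -> end_cell b t !=set0.
Proof. by move=> tO; rewrite end_cell_idx; exact: cell_neq0 tO (end_idx_lt tO). Qed.

End Ends.

Section PObjProper.
Variables (R : realType) (X : sds R) (b : bool).

Lemma seg_ext_end_cell n m : (n <= m)%N -> forall e : seg (P_obj X) n m, ext b e ->
  end_cell b (val (rng e)) `<=` end_cell b (val (src e)).
Proof.
elim: m => [|m IH].
  by rewrite leqn0 => /eqP-> e _; rewrite (diag_eq e).
rewrite leq_eqVlt => /predU1P[->|].
  by rewrite seg_nn => e _; rewrite (diag_eq e).
rewrite ltnS => nm; rewrite segS // => e ee.
apply: subset_trans (IH nm _ (ext_comp1 ee)).
rewrite (eqP (valP e)); apply: ext_E_tower (ext_comp2 (seg_rng nm) ee).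
- exact: part_refines.
- exact: part_topS.
Qed.

Let z : system X := if b then base (system X) else dyn (base (system X)).

(** Bottoms are the images of tops under the injective map [dyn], so their intersection is the image
    of the base point. *)
Lemma ends_bigcap : \bigcap_n ends b (part X n.+1) = [set z].
Proof.
have E : \bigcap_n top (towers (part X n.+1)) = [set base (system X)].
  rewrite -part_top_bigcap; apply/seteqP; split=> x H.
    by case=> [//|n _]; exact: H.
  by move=> n _; exact: H.
rewrite /ends /z; case: b => //.
have -> : (fun n => bottom (towers (part X n.+1)))
        = (fun n => @dyn R (system X) @` top (towers (part X n.+1))).
  by apply/funext => n; rewrite top_bottom.
have [g [_ _ gK _]] := @dyn_homeo R (system X).
apply/seteqP; split=> [x H|_ -> n _].
  have [y _ yx] := H 0 I; suff <- : y = base (system X) by [].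
  have : [set base (system X)] y; last by [].
  rewrite -E => n _; have [y' y'P] := H n I.
  by rewrite -yx => /(can_inj gK) <-.
have : [set base (system X)] (base (system X)) by [].
by rewrite -{1}E => /(_ n I); exists (base (system X)).
Qed.

Lemma P_obj_eventually_const : eventually_const b (P_obj X).
Proof.
move=> n; have zn : ends b (part X n) z.
  case: (n) => [|m].
    by apply/endsP; exists [:: setT]; rewrite ?part0 ?inE // /end_cell; case: b.
  have : [set z] z by [].
  by rewrite -{1}ends_bigcap => /(_ m I).
have [t tP tz] := (endsP b _ _).1 zn.
have [oT _] := end_cell_clopen b tP.
(* [end_cell b t] is an open neighbourhood of [z], so the ends of a late partition all lie inside
   it. *)
have [||||m Hm] := @compact_nested_sub (system X) (fun m => ends b (part X m.+1)) _ _ _ _ oT.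
- exact: space_compact.
- by move=> k; have [] := ends_clopen b (part X k.+1).
- move=> k; have sub := part_topS (X := X) (n := k.+1); rewrite /ends; case: b => //.
  exact: bottom_mono.
- by rewrite ends_bigcap => _ ->.
have le : (n <= maxn n m.+1)%N := leq_maxl _ _.
have mono k l : (k <= l)%N -> ends b (part X l) `<=` ends b (part X k).
  elim: l => [|l IH]; first by rewrite leqn0 => /eqP->.
  rewrite leq_eqVlt => /predU1P[->//|/IH]; apply: subset_trans.
  have sub := part_topS (X := X) (n := l); rewrite /ends; case: b => //.
  exact: bottom_mono.
(* A point of the end cell of the range lies in the end cells of both [src e] and [t], and distinct
   cells are disjoint. *)
have H (e : seg (P_obj X) n (maxn n m.+1)) : ext b e -> val (src e) = t.
  move=> ee; have [x xr] := end_cell_neq0 b (valP (rng e)).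
  have xs := seg_ext_end_cell le ee xr.
  apply: (end_cell_inj (valP (src e)) tP xs); apply: Hm.
  apply: mono (leq_maxr n m.+1) _ _; apply/endsP.
  by exists (val (rng e)); first exact: valP.
by exists (maxn n m.+1) => // e e' /H E /H E'; apply: val_inj; rewrite /= E E'.
Qed.

End PObjProper.

(** * Inverse limits of finite sets *)

(** Otherwise the complements of all fibres would belong to [U], and so would their finite
    intersection, which is empty. *)
Lemma ultra_finite (I : Type) (U : set_system I) (T : finType) (f : I -> T) :
  UltraFilter U -> exists t, U [set i | f i = t].
Proof.
move=> UU; apply: contrapT => /forallNP nU.
have : U (\bigcap_(t in [set` enum T]) ~` [set i | f i = t]).
  rewrite bigcap_seq; apply: (big_ind U) => [|A B|t _]; [exact: filterT|exact: filterI|].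
  by have [/nU|] := in_ultra_setVsetC [set i | f i = t] UU.
by move=> /filter_ex[i /(_ (f i))]; apply; rewrite /= ?mem_enum.
Qed.

(** Lifts are chosen above level [m] and projections taken below. The induction on [m] shifts the
    whole system by one level, which avoids transport between the types [P n]. *)
Lemma thread_through (P : nat -> finType) (pi : forall n, P n.+1 -> P n) :
  (forall n p, exists q, pi n q = p) ->
  forall m (p : P m), exists x : forall n, P n,
    (forall n, pi n (x n.+1) = x n) /\ x m = p.
Proof.
move=> surj m; elim: m P pi surj => [|m IH] P pi surj p.
  have /dependent_choice[g gP] (n : nat) :
      exists g : P n -> P n.+1, forall p, pi n (g p) = p.
    by have /choice[g gP] := surj n; exists g.
  pose x := fix x n : P n := if n is k.+1 then g k (x k) else p.
  by exists x; split=> [n|]; [exact: gP|].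
have [x [xP xm]] := IH (fun n => P n.+1) (fun n => pi n.+1) (fun n => surj n.+1) p.
exists (fun n => if n is k.+1 then x k else pi 0 (x 0)); split=> // -[//|n].
exact: xP.
Qed.

(** [R] is a parameter of the type so that a canonical metric with values in [R] can be attached to
    it. *)
Definition invlim (R : realType) (P : nat -> finType)
    (pi : forall n, P n.+1 -> P n) : Type :=
  {x : forall n, P n | forall n, pi n (x n.+1) = x n}.

Section InverseLimit.
Variables (R : realType) (P : nat -> finType) (pi : forall n, P n.+1 -> P n).
Local Notation X := (invlim R pi).

HB.instance Definition _ := gen_eqMixin X.
HB.instance Definition _ := gen_choiceMixin X.

Definition stage (x : X) n : P n := sval x n.

Lemma stageS (x : X) n : pi (stage x n.+1) = stage x n.
Proof. exact: svalP x n. Qed.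

Lemma stage_inj (x y : X) : (forall n, stage x n = stage y n) -> x = y.
Proof.
case: x y => [x xP] [y yP] H.
by apply: eq_exist; apply: functional_extensionality_dep.
Qed.

Lemma stage_down (x y : X) n m : (n <= m)%N ->
  stage x m = stage y m -> stage x n = stage y n.
Proof.
elim: m => [|m IH]; first by rewrite leqn0 => /eqP->.
rewrite leq_eqVlt => /predU1P[->//|/IH H] E; apply: H.
by rewrite -(stageS x) E stageS.
Qed.

Local Open Scope ring_scope.

(** The usual ultrametric on threads: being close means agreeing up to a late stage. *)
Definition invlim_dist (x y : X) : R :=
  if pselect (exists n, stage x n != stage y n) is left e
  then (ex_minn e).+1%:R^-1 else 0.

Lemma invlim_dist_sep x y n :
  stage x n != stage y n -> n.+1%:R^-1 <= invlim_dist x y.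
Proof.
rewrite /invlim_dist; case: pselect => [e|ne] H; last by case: ne; exists n.
case: ex_minnP => m _ /(_ _ H) mn.
by rewrite lef_pV2 ?posrE // ler_nat.
Qed.

Lemma invlim_dist_lt x y n :
  stage x n = stage y n -> invlim_dist x y < n.+1%:R^-1.
Proof.
move=> E; rewrite /invlim_dist; case: pselect => [e|_]; last by rewrite invr_gt0.
case: ex_minnP => m H _.
rewrite ltf_pV2 ?posrE // ltr_nat ltnS ltnNge; apply/negP => mn.
by rewrite (stage_down mn E) eqxx in H.
Qed.

Lemma invlim_dist_ge0 x y : 0 <= invlim_dist x y.
Proof. by rewrite /invlim_dist; case: pselect => // e; rewrite invr_ge0. Qed.

Lemma invlim_dist0 x : invlim_dist x x = 0.
Proof. by rewrite /invlim_dist; case: pselect => // e; case: ex_minnP => n; rewrite eqxx. Qed.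

Lemma invlim_dist_eq0 x y : invlim_dist x y = 0 -> x = y.
Proof.
move=> E; apply: stage_inj => n; apply/eqP/negPn/negP => /invlim_dist_sep.
by rewrite E leNgt invr_gt0 ltr0n.
Qed.

(** At the first stage separating [x] from [y], the point [z] differs from one of them. With [z] on
    the left of both terms, symmetry follows by taking [z] to be [y]. *)
Lemma invlim_dist_le x y z : invlim_dist x y <= invlim_dist z x + invlim_dist z y.
Proof.
rewrite {1}/invlim_dist; case: pselect => [e|_]; last by rewrite addr_ge0 ?invlim_dist_ge0.
case: ex_minnP => m H _.
have [E|ne] := eqVneq (stage z m) (stage x m).
  rewrite -E in H.
  by apply: le_trans (invlim_dist_sep H) _; rewrite lerDr invlim_dist_ge0.
by apply: le_trans (invlim_dist_sep ne) _; rewrite lerDl invlim_dist_ge0.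
Qed.

Lemma invlim_dist_sym x y : invlim_dist x y = invlim_dist y x.
Proof.
have H u v : invlim_dist u v <= invlim_dist v u.
  by have := invlim_dist_le u v v; rewrite invlim_dist0 addr0.
by apply/eqP; rewrite eq_le !H.
Qed.

Lemma invlim_dist_triangle y x z :
  invlim_dist x z <= invlim_dist x y + invlim_dist y z.
Proof. by rewrite (invlim_dist_sym x y) invlim_dist_le. Qed.

HB.instance Definition _ := @isMetric.Build R X invlim_dist invlim_dist0
  invlim_dist_eq0 invlim_dist_sym invlim_dist_triangle.

Local Close Scope ring_scope.

Definition cyl n (p : P n) : set X := [set x | stage x n = p].

(** The ball of radius 1/(n+1) is the cylinder of level [n]. *)
Lemma invlim_nbhs (x : X) (A : set X) :
  nbhs x A <-> exists n, cyl (stage x n) `<=` A.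
Proof.
rewrite -nbhs_ballE; split=> [[e /= e0 xA]|[n xA]].
  have [n ne] : exists n, (n.+1%:R^-1 < e :> R)%R.
    (* Truncation rounds down, so 1/e < k + 1. *)
    pose k := Num.truncn e^-1; exists k.
    rewrite invf_plt ?posrE // ?ltr0n //.
    by rewrite truncnS_gt // invr_ge0 ltW.
  exists n => y /= yx; apply: xA; rewrite ballEmdist /=.
  by apply: lt_trans ne; apply: invlim_dist_lt.
exists n.+1%:R^-1%R => /=; first by rewrite invr_gt0.
move=> y; rewrite ballEmdist /= => xy; apply: xA.
apply/eqP/negPn/negP; rewrite eq_sym => /invlim_dist_sep.
by rewrite leNgt xy.
Qed.

Lemma cyl_clopen n (p : P n) : clopen (cyl p).
Proof.
split.
  by rewrite openE => x /= xp; apply/invlim_nbhs; exists n => y; rewrite /cyl /= xp.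
move=> x H; have [|y [/= <- ->//]] := H (cyl (stage x n)).
by apply/invlim_nbhs; exists n.
Qed.

Lemma invlim_zero_dimensional : zero_dimensional X.
Proof.
move=> x y /eqP xy; have [n ne] : exists n, stage x n <> stage y n.
  by apply: contrapT => /forallNP H; apply: xy; apply: stage_inj => n; apply: contrapT.
by exists (cyl (stage x n)); split; [exact: cyl_clopen| |exact/nesym].
Qed.

(** The values selected by [U] at successive stages are compatible because two members of [U] always
    meet. *)
Lemma ultra_invlim (I : Type) (U : set_system I) (f : I -> X) : UltraFilter U ->
  exists x : X, forall n, U [set i | stage (f i) n = stage x n].
Proof.
move=> UU; have /dependent_choice[x xU] (n : nat) :=
  ultra_finite (fun i => stage (f i) n) UU.
have xP n : pi (x n.+1) = x n.
  have [i [/= <- <-]] := filter_ex (filterI (xU n.+1) (xU n)).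
  exact: stageS.
by exists (exist _ x xP).
Qed.

Lemma invlim_compact : compact [set: X].
Proof.
rewrite compact_ultra => U UU _; have [x xU] := ultra_invlim id UU.
exists x; split=> // A /invlim_nbhs[n xA].
by apply: filterS xA _; exact: xU.
Qed.

Lemma invlim_metrizable : metrizable R X.
Proof. by exists X, id, id; split=> // x A. Qed.

(** Plays the role of a common convergent subsequence of [f] and [g]: both limits are taken along
    one ultrafilter containing the tails. *)
Lemma seq_limits (f g : nat -> X) : exists x y : X,
  forall n N, exists i,
    [/\ (N <= i)%N, stage (f i) n = stage x n & stage (g i) n = stage y n].
Proof.
have [U [UU sU]] := ultraFilterLemma eventually_filter.
have [x xU] := ultra_invlim f UU; have [y yU] := ultra_invlim g UU.
exists x, y => n N.
have NU : U [set i | (N <= i)%N] by apply: sU; exists N.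
have [i [Ni [xi yi]]] := filter_ex (filterI NU (filterI (xU n) (yU n))).
by exists i.
Qed.

End InverseLimit.

(** * The Vershik map *)

Section Paths.
Variables (B : obd).

Definition fin_path n : oedge (vertex B 0) (vertex B n) := seg B 0 n.

Definition lastedge n (p : fin_path n.+1) : edge B n :=
  (val (p : ocomp (seg B 0 n) (edge B n))).2.

Definition trunc n (p : fin_path n.+1) : fin_path n :=
  (val (p : ocomp (seg B 0 n) (edge B n))).1.

Lemma fin_path_inj n (p q : fin_path n.+1) :
  trunc p = trunc q -> lastedge p = lastedge q -> p = q.
Proof.
rewrite /trunc /lastedge => E1 E2; apply: val_inj; move: E1 E2.
by case: (val p) (val q) => [? ?] [? ?] /= -> ->.
Qed.

Lemma rng_trunc n (p : fin_path n.+1) : rng (trunc p) = src (lastedge p).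
Proof. exact/eqP/(valP (p : ocomp (seg B 0 n) (edge B n))). Qed.

Lemma rng_lastedge n (p : fin_path n.+1) : rng p = rng (lastedge p).
Proof. by []. Qed.

Lemma fin_path_rcons n (p : fin_path n) (e : edge B n) : rng p = src e ->
  exists q : fin_path n.+1, trunc q = p /\ lastedge q = e.
Proof.
move=> /eqP E.
by exists (exist _ (p, e) E : ocomp (seg B 0 n) (edge B n)).
Qed.

Lemma trunc_surj n (p : fin_path n) : exists q : fin_path n.+1, trunc q = p.
Proof.
have [e es] := src_surj (rng p).
by have [q [? _]] := fin_path_rcons (esym es); exists q.
Qed.

Lemma fin_path_rng n (v : vertex B n) : exists p : fin_path n, rng p = v.
Proof. exact: seg_rng. Qed.

Lemma fin_path0 (p q : fin_path 0) : p = q.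
Proof.
apply: (@diag_inj (vertex B) 0 0); apply/eqP.
have /eqP/fintype1P[v vP] := vertex0 B.
by rewrite (vP (val p).2) (vP (val q).2).
Qed.

Lemma ext_trunc b n (p : fin_path n.+1) : ext b p -> ext b (trunc p).
Proof. exact: ext_comp1. Qed.

Lemma ext_lastedge b n (p : fin_path n.+1) : ext b p -> ext b (lastedge p).
Proof. exact/ext_comp2/seg_rng. Qed.

Lemma vadj_trunc b n (p q : fin_path n.+1) :
  vadj b p q -> vadj b (trunc p) (trunc q).
Proof. exact: vadj_comp. Qed.

End Paths.

Notation paths R B := (invlim R (@trunc B)).

Section PathSpace.
Variables (R : realType) (B : obd).
Local Notation X := (paths R B).

Lemma path_through n (p : fin_path B n) : exists x : X, stage x n = p.
Proof.
by have [x [xP xn]] := thread_through (@trunc_surj B) p; exists (exist _ x xP).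
Qed.

Lemma ext_stage_down b (x : X) n m : (n <= m)%N ->
  ext b (stage x m) -> ext b (stage x n).
Proof.
elim: m => [|m IH]; first by rewrite leqn0 => /eqP->.
rewrite leq_eqVlt => /predU1P[->//|/IH H] /ext_trunc.
by rewrite stageS.
Qed.

Lemma vadj_stage_down b (x y : X) n m : (n <= m)%N ->
  vadj b (stage x m) (stage y m) -> vadj b (stage x n) (stage y n).
Proof.
elim: m => [|m IH]; first by rewrite leqn0 => /eqP->.
rewrite leq_eqVlt => /predU1P[->//|/IH H] /vadj_trunc.
by rewrite !stageS.
Qed.

Lemma ext_path_at b n : exists x : X, ext b (stage x n).
Proof.
have /card_gt0P[v _] := vertex_gt0 B n; have [p _] := fin_path_rng v.
have [q _ qe] := ext_exists b p; have [x xq] := path_through q.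
by exists x; rewrite xq.
Qed.

(** A limit of paths that are extremal up to later and later levels, extremality being inherited by
    truncations. *)
Lemma ext_path_exists b : exists x : X, forall n, ext b (stage x n).
Proof.
have /choice[f fP] := ext_path_at b.
have [x [y xP]] := seq_limits f f; exists x => n.
by have [i [ni <- _]] := xP n n; exact: ext_stage_down ni (fP i).
Qed.

Definition unique_ext_path b : Prop :=
  exists! p : forall n, edge B n, is_path p /\ forall n, ext b (p n).

Lemma ext_path_uniq b (x y : X) : unique_ext_path b ->
  (forall n, ext b (stage x n)) -> (forall n, ext b (stage y n)) -> x = y.
Proof.
move=> [p [_ pU]] xe ye.
(* The last edges of an extremal thread form an infinite extremal path, and [p] is the only one. *)
have E (z : X) : (forall n, ext b (stage z n)) ->
    p = fun n => lastedge (stage z n.+1).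
  move=> ze; apply: pU; split=> n; last exact: ext_lastedge.
  by rewrite -rng_trunc stageS -rng_lastedge.
have {}E n : lastedge (stage x n.+1) = lastedge (stage y n.+1).
  by rewrite -(congr1 (@^~ n) (E x xe)) -(congr1 (@^~ n) (E y ye)).
apply: stage_inj; elim=> [|n IH]; first exact: fin_path0.
by apply: fin_path_inj; rewrite ?stageS.
Qed.

(** The uniform form of [ext_path_uniq]: counterexamples at every [m] would converge to two extremal
    paths that differ at stage [n]. *)
Lemma ext_path_const b n : unique_ext_path b ->
  exists m, forall x y : X, ext b (stage x m) -> ext b (stage y m) ->
    stage x n = stage y n.
Proof.
move=> U; apply: contrapT => /forallNP H.
have /choice[f /choice[g fgP]] m : exists x y : X,
    [/\ ext b (stage x m), ext b (stage y m) & stage x n <> stage y n].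
  have /existsNP[x /existsNP[y /not_implyP[? /not_implyP[? ?]]]] := H m.
  by exists x, y.
have [x [y xyP]] := seq_limits f g.
suff E : x = y.
  by have [i [_ xi yi]] := xyP n 0; have [_ _] := fgP i; rewrite xi yi E.
apply: (ext_path_uniq U) => k; have [i [ki xi yi]] := xyP k k.
  by rewrite -xi; apply: ext_stage_down ki _; have [] := fgP i.
by rewrite -yi; apply: ext_stage_down ki _; have [] := fgP i.
Qed.

Definition adj b (x y : X) : Prop := forall n, vadj b (stage x n) (stage y n).

Lemma adj_exists b x : exists y, adj b x y.
Proof.
have /choice[g gP] n : exists y : X, vadj b (stage x n) (stage y n).
  have [q xq] := vadj_exists b (stage x n); have [y yq] := path_through q.
  by exists y; rewrite yq.
have [z [y yP]] := seq_limits g g; exists y => n.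
have [i [ni _ <-]] := yP n n; exact: vadj_stage_down ni (gP i).
Qed.

Lemma adjN b x y : adj (~~ b) x y -> adj b y x.
Proof. by move=> H n; apply/vadjN. Qed.

(** If [x] is extremal at every level, its image is the opposite extremal path; otherwise every late
    truncation of [x] has a unique successor. *)
Lemma adj_uniq b x y z : unique_ext_path (~~ b) ->
  adj b x y -> adj b x z -> y = z.
Proof.
move=> U xy xz.
have [ex|/existsNP[n nex]] := pselect (forall n, ext b (stage x n)).
  by apply: (ext_path_uniq U) => n; apply: vadj_ext (ex n).
apply: stage_inj => m.
apply: (@stage_down _ _ _ _ _ _ (maxn n m)); first exact: leq_maxr.
have nex' : ~ ext b (stage x (maxn n m)).
  by move=> /ext_stage_down ex; apply: nex; apply: ex; exact: leq_maxl.
exact: cov_uniq (vadj_next (xy _) nex') (vadj_next (xz _) nex').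
Qed.

(** With [b] true this is the Vershik map; with [b] false it is its inverse, once the diagram is
    properly ordered. *)
Definition vershik b (x : X) : X := sval (cid (adj_exists b x)).

Lemma vershik_adj b x : adj b x (vershik b x).
Proof. exact: svalP (cid (adj_exists b x)). Qed.

Hypothesis po : forall b, unique_ext_path b.

Lemma vershikP b x y : adj b x y -> vershik b x = y.
Proof. exact: adj_uniq (po _) (vershik_adj b x). Qed.

Lemma vershikK b : cancel (vershik b) (vershik (~~ b)).
Proof. by move=> x; apply: vershikP; apply: adjN; rewrite negbK; exact: vershik_adj. Qed.

(** Away from the extremal path, a late truncation of [x] determines its successor. Near it, images
    are opposite-extremal up to a high level, hence agree at stage [n] by [ext_path_const]. *)
Lemma vershik_continuous b : continuous (vershik b).
Proof.
move=> x A /invlim_nbhs[n xA]; apply/invlim_nbhs.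
suff [m mP] : exists m, forall y, stage y m = stage x m ->
    stage (vershik b y) n = stage (vershik b x) n.
  by exists m => y /mP ?; exact: xA.
have [ex|/existsNP[k nex]] := pselect (forall n, ext b (stage x n)).
  have [m mP] := ext_path_const n (po (~~ b)); exists m => y E.
  apply: mP; first by apply: vadj_ext (vershik_adj b y m) _; rewrite E.
  exact: vadj_ext (vershik_adj b x m) _.
exists (maxn n k) => y E; apply: stage_down (leq_maxl n k) _.
have nex' : ~ ext b (stage x (maxn n k)).
  by move=> /ext_stage_down ex; apply: nex; apply: ex; exact: leq_maxr.
have := vadj_next (vershik_adj b x _) nex'; apply: cov_uniq.
by rewrite -E in nex' *; exact: vadj_next (vershik_adj b y _) nex'.
Qed.

Lemma vershik_homeo b : homeo (vershik b).
Proof.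
exists (vershik (~~ b)); split.
- exact: vershik_continuous.
- exact: vershik_continuous.
- exact: vershikK.
- by have := vershikK (~~ b); rewrite negbK.
Qed.

Definition ext_path b : X := sval (cid (ext_path_exists b)).

Lemma ext_pathP b n : ext b (stage (ext_path b) n).
Proof. exact: svalP (cid (ext_path_exists b)) n. Qed.

Lemma ext_pathE b x : (forall n, ext b (stage x n)) -> x = ext_path b.
Proof. by move=> xe; apply: (ext_path_uniq (po b) xe); exact: ext_pathP. Qed.

(** Each application moves a non-maximal truncation strictly up in its finite fibre, so a maximal
    one is reached. *)
Lemma vershik_reach n x :
  exists k, ext true (stage (iter k (vershik true) x) n).
Proof.
have [c] := ubnP #|[pred q | dle true (stage x n) q]|; elim: c x => // c IH x le.
have [ex|nex] := pselect (ext true (stage x n)); first by exists 0.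
have [k kP] : exists k, ext true (stage (iter k (vershik true) (vershik true x)) n).
  have [xy nxy _] := vadj_next (vershik_adj true x n) nex.
  apply: IH; rewrite ltnS in le; apply: leq_trans le; apply: proper_card.
  apply/properP; split; first by apply/fintype.subsetP => z; exact: dle_trans.
  exists (stage x n); rewrite !inE ?dle_refl //; apply/negP => yx.
  exact: nxy (dle_anti xy yx).
by exists k.+1; rewrite iterSr.
Qed.

Lemma ext_clopen b n : clopen [set x : X | ext b (stage x n)].
Proof.
have -> : [set x : X | ext b (stage x n)] =
    \bigcup_(p in [set` enum [pred p : fin_path B n | `[< ext b p >]]]) cyl p.
  apply/seteqP; split=> [x xe|x [p /= + ->]].
    exists (stage x n); last by [].
    by rewrite /= mem_enum inE.
  by rewrite mem_enum inE.
split; first by apply: bigcup_open => p _; have [] := cyl_clopen R (@trunc B) p.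
by rewrite bigcup_seq; apply: closed_bigsetU => p _; have [] := cyl_clopen R (@trunc B) p.
Qed.

(** If [A] missed the maximal path, by compactness it would miss all paths maximal up to some level,
    but every orbit meets those. *)
Lemma closed_invariant_ext_path (A : set X) :
  closed_invariant (vershik true) A -> A (ext_path true).
Proof.
move=> [[x Ax] cA iA]; apply: contrapT => nA.
have [|||||n nP] := @compact_nested_sub X (fun n => [set x | ext true (stage x n)]) (~` A).
- exact: invlim_compact.
- by move=> n; have [] := ext_clopen true n.
- by move=> n y; exact: ext_stage_down.
- exact: closed_openC.
- by move=> y yP; rewrite (@ext_pathE true y) // => n; exact: yP.
have Ak k : A (iter k (vershik true) x).
  by elim: k => //= k IH; rewrite -iA; exists (iter k (vershik true) x).
by have [k /nP] := vershik_reach n x; apply.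
Qed.

(** All closed invariant sets share the maximal path, so their intersection is nonempty and is the
    least of them. *)
Lemma vershik_minimal :
  minimal_set (vershik true) (\bigcap_(A in closed_invariant (vershik true)) A).
Proof.
have [g [_ _ gK Kg]] := vershik_homeo true.
split; first split.
- by exists (ext_path true) => A; exact: closed_invariant_ext_path.
- by apply: closed_bigI => A [].
- apply/seteqP; split=> [_ [x xP <-] A iA|x xP].
    by have [_ _ <-] := iA; exists x => //; exact: xP.
  exists (g x); last exact: Kg.
  move=> A iA; have := xP A iA; have [_ _ {1}<-] := iA.
  by move=> [y Ay <-]; rewrite gK.
- by move=> A iA AM; apply/seteqP; split=> // x; exact.
Qed.

Lemma vershik_ess_minimal : exists! M, minimal_set (vershik true) M.
Proof.
exists (\bigcap_(A in closed_invariant (vershik true)) A); split.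
  exact: vershik_minimal.
move=> M [iM mM]; apply: mM; first by have [] := vershik_minimal.
by move=> x; exact.
Qed.

Lemma ext_path_minimal (M : set X) :
  minimal_set (vershik true) M -> M (ext_path true).
Proof. by move=> [iM _]; exact: closed_invariant_ext_path. Qed.

Definition path_emds : emds R :=
  @EMDS R X (vershik true) (ext_path true) (@invlim_metrizable R _ _)
    (@invlim_compact R _ _)
    (zero_dimension_totally_disconnected (@invlim_zero_dimensional R _ _))
    (vershik_homeo true) vershik_ess_minimal ext_path_minimal.

End PathSpace.

(** * Kakutani-Rokhlin partitions of the path space *)

Section Graph.
Variables (S T : finType) (a : S -> T) (a_inj : injective a).

Lemma graph_comparable (x y : S) : (x == y) || (y == x) = (a x == a y).
Proof. by rewrite (eq_sym y) orbb (inj_eq a_inj). Qed.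

Lemma eq_anti (U : eqType) : antisymmetric (@eq_op U).
Proof. by move=> x y /andP[/eqP]. Qed.

Lemma eq_op_trans (U : eqType) : transitive (@eq_op U).
Proof. by move=> x y z /eqP-> /eqP->. Qed.

(** An injective map as an ordered edge set: each fibre has at most one edge, so equality serves as
    the order. *)
Definition graph : oedge S T :=
  @OEdge S T S id a (@eq_op S) (@eqxx _) (@eq_anti _) (@eq_op_trans _)
    graph_comparable.

End Graph.

Lemma graph_diag (V : nat -> finType) (T : finType) n (a : V n -> T) (a' : T -> V n)
    (a_inj : injective a) (a'_inj : injective a') : cancel a a' ->
  oiso (ocomp (graph a_inj) (graph a'_inj)) (diag V n n).
Proof.
move=> aK; apply: (@oisoI _ _ (ocomp (graph a_inj) (graph a'_inj)) (diag V n n)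
  (fun x => exist _ ((val x).1, (val x).1) (diagP (val x).1))) => //=.
- by move=> x; rewrite -[LHS]aK; congr a'; exact: eqP (valP x).
- move=> x y; rewrite /comp_le /= -val_eqE /= xpair_eqE andbb.
  rewrite -(eqP (valP x)) -(eqP (valP y)) /= (inj_eq a_inj).
  by case: eqP.
- move=> d; have p : rng ((val d).1 : graph a_inj) == src (a (val d).1 : graph a'_inj).
    exact: eqxx.
  exists (exist _ ((val d).1, a (val d).1) p); apply: diag_inj => /=.
  exact: diag_eq d.
Qed.

Section Levelwise.
Variables (B C : obd) (a : forall n, vertex B n -> vertex C n)
  (h : forall n, edge B n -> edge C n).
Hypotheses (a_bij : forall n, bijective (@a n))
  (h_surj : forall n e', exists e, @h n e = e')
  (h_src : forall n (e : edge B n), src (h e) = a (src e))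
  (h_rng : forall n (e : edge B n), rng (h e) = a (rng e))
  (h_ole : forall n (e e' : edge B n), ole (h e) (h e') = ole e e').

Let a_inj n : injective (@a n) := bij_inj (a_bij n).

Lemma order_embedding_inj n : injective (@h n).
Proof.
by move=> e e' E; apply: ole_anti; rewrite -!h_ole E ole_refl.
Qed.

(** An edge [e] followed by the arrow at its range corresponds to the arrow at its source followed
    by [h e]. *)
Lemma graph_comm n : oiso (ocomp (edge B n) (graph (@a_inj n.+1)))
  (ocomp (graph (@a_inj n)) (seg C n n.+1)).
Proof.
apply: oiso_trans (oiso_comp (oiso_refl _) (oiso_sym (seg1 C n))).
have P (x : ocomp (edge B n) (graph (@a_inj n.+1))) :
  rng (src (val x).1 : graph (@a_inj n)) == src (h (val x).1).
  by rewrite h_src.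
apply: (@oisoI _ _ (ocomp (edge B n) (graph (@a_inj n.+1)))
  (ocomp (graph (@a_inj n)) (edge C n))
  (fun x => exist _ (src (val x).1, h (val x).1) (P x))) => //=.
- by move=> x; rewrite h_rng; congr a; exact: eqP (valP x).
- move=> x y; rewrite /comp_le /= (inj_eq (@order_embedding_inj n)) h_ole.
  have -> : (val x).2 = rng (val x).1 by rewrite (eqP (valP x)).
  have -> : (val y).2 = rng (val y).1 by rewrite (eqP (valP y)).
  have [->|ne] := eqVneq (val x).1 (val y).1; first by rewrite !eqxx ole_refl.
  rewrite orbF andTb; have [E|nr] := eqVneq (rng (val x).1) (rng (val y).1).
    by [].
  rewrite /=; case E: (ole (val x).1 (val y).1) => //.
  by rewrite (ole_rng E) eqxx in nr.
- move=> [[v c] /= p]; have [e ec] := h_surj c.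
  have q : rng e == src (rng e : graph (@a_inj n.+1)) by exact: eqxx.
  exists (exist _ (e, rng e) q); apply: val_inj => /=; rewrite ec; congr (_, _).
  by apply: a_inj; rewrite -h_src ec -(eqP p).
Qed.

Lemma graph_gt0 n : (0 < #|graph (@a_inj n)|)%N.
Proof. exact: vertex_gt0. Qed.

Lemma graph_src n v : exists e : graph (@a_inj n), src e = v.
Proof. by exists v. Qed.

Lemma graph_rng n w : exists e : graph (@a_inj n), rng e = w.
Proof. by have [b _ bK] := a_bij n; exists (b w); exact: bK. Qed.

Definition graph_premor : premor B C :=
  @Premor B C id erefl leqnSn (fun m => ex_intro _ m (leqnn m))
    (fun n => graph (@a_inj n)) graph_gt0 graph_src graph_rng (vertex0 B) graph_comm.

End Levelwise.

Lemma pequiv_pid (B : obd) (f : premor B B) (lf : forall n, lvl f n = n) :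
  (forall n, oiso (pedge f n) (diag (vertex B) n (lvl f n))) -> pequiv f (pid B).
Proof.
case: f lf => l l0 lle lu F Fgt Fs Fr F1 Fc /= lf.
have E : l = id by apply/funext.
(* The types of the edge sets depend on the level function, so its equality with [id] is substituted
   before they are compared. *)
move: l0 lle lu F Fgt Fs Fr F1 Fc {lf}; rewrite E => l0 lle lu F Fgt Fs Fr F1 Fc i.
(* Odd and even levels interlace, and starting at 1 keeps the indices positive. *)
exists (fun k => k.*2.+1), (fun k => k.*2.+2) => k; split=> //=.
- apply: oiso_trans (ocomp_diagr _) _; apply: oiso_sym.
  apply: oiso_trans (oiso_comp (i _) (oiso_refl _)) _; exact: ocomp_diagl.
- apply: oiso_trans (oiso_comp (oiso_refl _) (i _)) _.
  by apply: oiso_trans (ocomp_diagr _) (oiso_sym (ocomp_diagl _)).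
Qed.

Lemma obd_iso_levelwise (B C : obd) (a : forall n, vertex B n -> vertex C n)
    (h : forall n, edge B n -> edge C n) :
  (forall n, bijective (@a n)) ->
  (forall n e', exists e, @h n e = e') ->
  (forall n (e : edge B n), src (h n e) = a n (src e)) ->
  (forall n (e : edge B n), rng (h n e) = a n.+1 (rng e)) ->
  (forall n (e e' : edge B n), ole (h n e) (h n e') = ole e e') ->
  obd_iso B C.
Proof.
move=> ab hs hsrc hrng hole.
have /dependent_choice[a' a'P] (n : nat) :
    exists a' : vertex C n -> vertex B n, cancel (a n) a' /\ cancel a' (a n).
  by have [a' ? ?] := ab n; exists a'.
have /dependent_choice[h' h'P] (n : nat) :
    exists h' : edge C n -> edge B n, cancel (h n) h' /\ cancel h' (h n).
  have /choice[h' h'K] := hs n; exists h'; split=> // e.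
  by apply: (order_embedding_inj hole); rewrite h'K.
have a'b n : bijective (a' n) by have [? ?] := a'P n; exists (a n).
have hs' n e : exists e', h' n e' = e by exists (h n e); have [-> _] := h'P n.
have hsrc' n (e : edge C n) : src (h' n e) = a' n (src e).
  have [hK h'K] := h'P n; have [aK a'K] := a'P n.
  by rewrite -{2}(h'K e) hsrc aK.
have hrng' n (e : edge C n) : rng (h' n e) = a' n.+1 (rng e).
  have [hK h'K] := h'P n; have [aK a'K] := a'P n.+1.
  by rewrite -{2}(h'K e) hrng aK.
have hole' n (e e' : edge C n) : ole (h' n e) (h' n e') = ole e e'.
  by have [_ h'K] := h'P n; rewrite -hole !h'K.
exists (graph_premor ab hs hsrc hrng hole), (graph_premor a'b hs' hsrc' hrng' hole').
split; apply: pequiv_pid => // n; apply: graph_diag; by have [] := a'P n.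
Qed.

(** * Positions in the fibres of an ordered edge set *)

Section Fibre.
Variables (S T : finType) (F : oedge S T).
Implicit Types p q : F.

Definition fibre (v : T) : seq F := sort (@ole _ _ F) (enum [pred p : F | rng p == v]).

Definition rank p : nat := index p (fibre (rng p)).

Lemma mem_fibre v p : (p \in fibre v) = (rng p == v).
Proof. by rewrite mem_sort mem_enum. Qed.

Lemma fibre_uniq v : uniq (fibre v).
Proof. by rewrite sort_uniq enum_uniq. Qed.

Lemma fibre_sorted v : sorted (@ole _ _ F) (fibre v).
Proof.
apply: (@sort_sorted_in _ [pred p | rng p == v]).
  by move=> p q; rewrite !inE ole_comparable => /eqP-> /eqP->.
by apply/allP => p; rewrite mem_enum.
Qed.

Lemma rank_lt p : (rank p < size (fibre (rng p)))%N.
Proof. by rewrite index_mem mem_fibre. Qed.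

Lemma rank_inj p q : rng p = rng q -> rank p = rank q -> p = q.
Proof.
rewrite /rank => E; rewrite E => I.
rewrite -(nth_index p (_ : p \in fibre (rng q))) ?mem_fibre ?E // I nth_index //.
by rewrite mem_fibre.
Qed.

Lemma rank_le p q : rng p = rng q -> ole p q = (rank p <= rank q)%N.
Proof.
move=> E; have H p' q' : rng p' = rng q' -> (rank p' <= rank q')%N -> ole p' q'.
  move=> E' le.
  have := sorted_leq_nth (@ole_trans _ _ F) (@ole_refl _ _ F) p' (fibre_sorted (rng q')).
  move=> /(_ (rank p') (rank q')).
  rewrite !inE rank_lt -E' rank_lt => /(_ isT isT le).
  by rewrite /rank -E' !nth_index // mem_fibre // E'.
apply/idP/idP => [pq|]; last exact: H.
rewrite leqNgt; apply/negP => lt; have /ltnW/H qp := lt.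
by rewrite (ole_anti (introT andP (conj pq (qp (esym E))))) ltnn in lt.
Qed.

Lemma rank_exists v j : (j < size (fibre v))%N -> exists p, rng p = v /\ rank p = j.
Proof.
move=> jv; have [p0] : exists p : F, p \in fibre v.
  by case: (fibre v) jv => // p s _; exists p; rewrite mem_head.
move=> _; have := mem_nth p0 jv; rewrite mem_fibre => /eqP E.
by exists (nth p0 (fibre v) j); rewrite /rank E index_uniq ?fibre_uniq.
Qed.

Lemma rank_cov p q : rng p = rng q -> rank q = (rank p).+1 -> cov true p q.
Proof.
move=> E I; split=> [||z pz zq].
- by rewrite /dle rank_le // I.
- by move=> pq; move: I; rewrite pq => /n_Sn.
- have Ez := dle_rng zq; rewrite /dle rank_le // in zq.
  rewrite /dle rank_le ?E // in pz; move: zq; rewrite I leq_eqVlt ltnS.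
  move=> /predU1P[E'|zp]; [right|left].
    by apply: rank_inj => //; rewrite E' I.
  by apply: rank_inj; rewrite ?E // ; apply/eqP; rewrite eqn_leq zp pz.
Qed.

Lemma ext_false_rank p : ext false p <-> rank p = 0.
Proof.
split=> [ep|p0 q]; last first.
  move=> qp; have E := dle_rng qp; rewrite /dle rank_le // p0 leqn0 in qp.
  by apply: rank_inj => //; rewrite p0 (eqP qp).
have [q [qr q0]] := rank_exists (leq_ltn_trans (leq0n _) (rank_lt p)).
by rewrite -q0; congr rank; apply/esym/ep; rewrite /dle rank_le // q0.
Qed.

Lemma ext_true_rank p : ext true p <-> (rank p).+1 = size (fibre (rng p)).
Proof.
split=> [ep|ps q]; last first.
  move=> pq; have E := dle_rng pq; rewrite /dle rank_le // in pq.
  apply: rank_inj => //; apply/eqP; rewrite eqn_leq pq andbT.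
  by have := rank_lt q; rewrite -E -ps ltnS.
have := rank_lt p; rewrite leq_eqVlt => /predU1P[//|/rank_exists[q [qr qE]]].
have E : q = p by apply: ep; rewrite /dle rank_le // qE.
by move: qE; rewrite E => /n_Sn.
Qed.

End Fibre.

(** * Towers of cylinders and the resulting diagram *)

Section PathTowers.
Variables (R : realType) (B : obd) (po : forall b, unique_ext_path B b).
Local Notation X := (paths R B).
Local Notation XE := (path_emds R po).

Definition path_tower n (v : vertex B n) : seq (set X) :=
  [seq cyl p | p <- fibre (fin_path B n) v].

Definition path_towers n : seq (seq (set X)) :=
  [seq path_tower v | v <- enum (vertex B n)].

Lemma size_path_tower n (v : vertex B n) :
  size (path_tower v) = size (fibre (fin_path B n) v).
Proof. by rewrite size_map. Qed.

Lemma path_tower_nth n (v : vertex B n) j x :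
  nth set0 (path_tower v) j x <-> rng (stage x n) = v /\ rank (stage x n) = j.
Proof.
(* Past the end of the tower the default [set0] is empty, and no path has so large a rank. *)
have [lt|ge] := ltnP j (size (fibre (fin_path B n) v)); last first.
  rewrite nth_default ?size_path_tower //; split=> // -[E E'].
  by rewrite -E' -E leqNgt rank_lt in ge.
have [p [pv pj]] := rank_exists lt.
rewrite (nth_map p) //; have -> : nth p (fibre (fin_path B n) v) j = p.
  by rewrite -pj -pv nth_index // mem_fibre.
split=> [->//|[E E']]; apply: rank_inj; first by rewrite E pv.
by rewrite E' pj.
Qed.

Lemma path_tower_in n (v : vertex B n) : path_tower v \in path_towers n.
Proof. by rewrite map_f // mem_enum. Qed.

Lemma path_towersP n t : t \in path_towers n -> exists v : vertex B n, t = path_tower v.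
Proof. by move=> /mapP[v _ ->]; exists v. Qed.

Lemma path_tower_inj n : injective (@path_tower n).
Proof.
move=> v w E; have [p pv] := fin_path_rng v; have [x xp] := path_through R p.
have := (path_tower_nth v (rank p) x).2; rewrite xp => /(_ (conj pv erefl)).
by rewrite E => /path_tower_nth[<- _]; rewrite xp.
Qed.

Lemma path_tower_gt0 n t : t \in path_towers n -> (0 < size t)%N.
Proof.
move=> /path_towersP[v ->]; have [p <-] := fin_path_rng v.
by rewrite size_path_tower (leq_ltn_trans (leq0n _) (rank_lt p)).
Qed.

Lemma path_cells n (A : set X) :
  cells (path_towers n) A <-> exists p : fin_path B n, A = cyl p.
Proof.
split=> [[[k j] /= [kn]]|[p ->]].
  rewrite /cell /=; have /path_towersP[v ->] := mem_nth [::] kn.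
  rewrite size_path_tower => /rank_exists[p [pv pj]] <-; exists p.
  rewrite (nth_map p); last by rewrite -pj -pv rank_lt.
  by rewrite -pj -pv nth_index // mem_fibre.
exists (index (path_tower (rng p)) (path_towers n), rank p).
  rewrite /cell_dom /= index_mem path_tower_in nth_index ?path_tower_in //.
  by rewrite size_path_tower rank_lt.
rewrite /cell /= nth_index ?path_tower_in // (nth_map p) ?rank_lt //.
by rewrite nth_index // mem_fibre.
Qed.

Lemma path_partition n :
  partition (cell_dom (path_towers n)) (cell (path_towers n)) [set: X].
Proof.
split.
- apply/seteqP; split=> // x _.
  have : cells (path_towers n) (cyl (stage x n) : set X) by apply/path_cells; exists (stage x n).
  by move=> [i Di E]; exists i => //; rewrite E.
- move=> [k j] [k' j'] [/= kn jn] [/= kn' jn'] [x []]; rewrite /cell /=.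
  (* Distinct vertices have distinct towers, so a tower determines its index in the list. *)
  have nthE (i : nat) : (i < size (path_towers n))%N -> forall v : vertex B n,
      nth [::] (path_towers n) i = path_tower v -> i = index (path_tower v) (path_towers n).
    move=> ik v <-; rewrite index_uniq // map_inj_uniq ?enum_uniq //.
    exact: path_tower_inj.
  have /path_towersP[v vE] := mem_nth [::] kn.
  have /path_towersP[w wE] := mem_nth [::] kn'.
  rewrite vE wE => /path_tower_nth[xv <-] /path_tower_nth[xw <-].
  by rewrite (nthE _ kn _ vE) (nthE _ kn' _ wE) -xv -xw.
- move=> i Di; have : cells (path_towers n) (cell (path_towers n) i) by exists i.
  by move=> /path_cells[p ->]; have [x xp] := path_through R p; exists x.
Qed.

Lemma path_cell_clopen n (A : set XE) : cells (path_towers n) A -> clopen A.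
Proof. by move=> /path_cells[p ->]; exact: cyl_clopen. Qed.

Lemma path_top n x : top (path_towers n) x <-> ext true (stage x n).
Proof.
split=> [[t /= /path_towersP[v ->]]|ex].
  rewrite -nth_last => /path_tower_nth[xv xr]; apply/ext_true_rank.
  rewrite xr xv size_path_tower prednK //.
  by have := path_tower_gt0 (path_tower_in v); rewrite size_path_tower.
exists (path_tower (rng (stage x n))); first exact: path_tower_in.
rewrite -nth_last; apply/path_tower_nth; split=> //.
by rewrite size_path_tower -(ext_true_rank _).1.
Qed.

Lemma path_bottom n x : bottom (path_towers n) x <-> ext false (stage x n).
Proof.
split=> [[t /= /path_towersP[v ->]]|ex].
  by rewrite -nth0 => /path_tower_nth[xv xr]; apply/ext_false_rank.
exists (path_tower (rng (stage x n))); first exact: path_tower_in.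
by rewrite -nth0; apply/path_tower_nth; split=> //; apply/ext_false_rank.
Qed.

Lemma vershik_surj (y : X) : exists2 x, vershik true x = y & adj true x y.
Proof.
exists (vershik false y); first exact: (vershikK po false).
by apply: (@adjN _ _ true); exact: vershik_adj.
Qed.

(** Neighbouring cells are cylinders of consecutive paths [p] and [q]; uniqueness of successors
    gives one inclusion, uniqueness of predecessors the other. *)
Lemma path_step n t j : t \in path_towers n -> (j.+1 < size t)%N ->
  @dyn R XE @` nth set0 t j = nth set0 t j.+1.
Proof.
move=> /path_towersP[v ->]; rewrite size_path_tower => jt.
have [p [pv pj]] := rank_exists (ltnW jt); have [q [qv qj]] := rank_exists jt.
have pq : cov true p q by apply: rank_cov; rewrite ?qj ?pv ?pj.
have [dpq npq _] := pq.
apply/seteqP; split=> [_ [x /path_tower_nth[xv xj] <-]|y /path_tower_nth[yv yj]].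
  have xp : stage x n = p by apply: rank_inj; rewrite ?xv ?xj.
  have := vershik_adj true x n; rewrite xp => /vadj_next H.
  have /(cov_uniq pq) E : cov true p (stage (vershik true x) n).
    by apply: H => /(_ _ dpq) /esym.
  by apply/path_tower_nth; rewrite -E.
have yq : stage y n = q by apply: rank_inj; rewrite ?yv ?yj.
have [x xy ax] := vershik_surj y; exists x => //.
(* The other case of [vadj] would make [q] minimal, although [p] lies below it. *)
have := ax n; rewrite yq => -[|[_ /(_ p)]]; last first.
  by rewrite dleN => /(_ dpq).
move/covN: pq => qp /covN /(cov_uniq qp) E.
by apply/path_tower_nth; rewrite -E.
Qed.

Lemma path_top_base n : top (path_towers n) (base XE).
Proof. by apply/path_top; exact: ext_pathP. Qed.

Lemma path_top_bottom n :
  @dyn R XE @` top (path_towers n) = bottom (path_towers n).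
Proof.
apply/seteqP; split=> [_ [x /path_top xe <-]|y /path_bottom ye].
  by apply/path_bottom; apply: vadj_ext (vershik_adj true x n) xe.
exists (vershik false y); last exact: (vershikK po false).
by apply/path_top; apply: vadj_ext (vershik_adj false y n) ye.
Qed.

Definition path_krp n : krp XE :=
  @KRP R XE (path_towers n) (@path_tower_gt0 n) (path_partition n)
    (@path_cell_clopen n) (@path_step n) (path_top_base n) (path_top_bottom n).

Lemma path_towers0 : path_towers 0 = [:: [:: setT]].
Proof.
have : size (path_towers 0) = 1%N by rewrite size_map -cardE vertex0.
rewrite /path_towers; case: (enum _) => [|v []] //= _; congr [:: _].
rewrite /path_tower; have [p pv] := fin_path_rng v.
have -> : fibre (fin_path B 0) v = [:: p].
  have := fibre_uniq (fin_path B 0) v; have := mem_fibre v p; rewrite pv eqxx.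
  case: (fibre _ _) => [|q [|r s]] // _; first by rewrite (fin_path0 q p).
  by rewrite (fin_path0 q p) (fin_path0 r p) /= inE eqxx.
rewrite /=; congr [:: _]; apply/seteqP; split=> // x _.
exact: fin_path0.
Qed.

Lemma path_refines n : refines (path_krp n) (path_krp n.+1).
Proof.
move=> A /path_cells[p ->]; exists (cyl (trunc p)).
  by apply/path_cells; exists (trunc p).
by move=> x /= <-; exact: esym (stageS x n).
Qed.

Lemma path_top_le n : top (path_towers n.+1) `<=` top (path_towers n).
Proof.
by move=> x /path_top xe; apply/path_top; exact: ext_stage_down (leqnSn n) xe.
Qed.

Lemma path_top_bigcap :
  \bigcap_(n in [set n | (1 <= n)%N]) top (path_towers n) = [set base XE].
Proof.
apply/seteqP; split=> [x H|_ -> n _]; last exact: path_top_base.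
(* The intersection starts at level 1, so extremality at stage [n] is read off stage [n.+1]. *)
apply: (ext_pathE po) => n; apply: ext_stage_down (leqnSn n) _.
by apply/path_top; exact: H.
Qed.

Lemma path_basis : @basis XE (\bigcup_n cells (path_towers n)).
Proof.
split=> [A [n _ /path_cell_clopen[]//]|x A /invlim_nbhs[n xA]].
exists (cyl (stage x n)) => //; split=> //; exists n => //.
by apply/path_cells; exists (stage x n).
Qed.

Definition path_sds : sds R :=
  @SDS R XE path_krp path_towers0 path_refines (fun n _ => @path_top_le n)
    path_top_bigcap path_basis.

Definition tower_vertex n (v : vertex B n) : vertex (P_obj path_sds) n :=
  SeqSub (path_tower_in v : path_tower v \in towers (path_krp n)).

Lemma tower_vertex_bij n : bijective (@tower_vertex n).
Proof.
have /choice[g gK] (t : vertex (P_obj path_sds) n) : exists v, tower_vertex v = t.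
  by have [v tv] := path_towersP (valP t); exists v; apply: val_inj.
exists g => // v; apply: (@path_tower_inj n).
by rewrite -[LHS]/(val (tower_vertex (g (tower_vertex v)))) gK.
Qed.

Lemma min_extension n (e : edge B n) : exists p : fin_path B n.+1,
  lastedge p = e /\ ext false (trunc p).
Proof.
have [q qe] := fin_path_rng (src e); have [p le pe] := ext_exists false q.
have [r [rp re]] := fin_path_rcons (etrans (esym (dle_rng le)) qe).
by exists r; rewrite rp.
Qed.

(** The last edge dominates the lexicographic order, and with equal last edges the minimal
    truncations coincide. *)
Lemma min_extension_le n (p q : fin_path B n.+1) :
  ext false (trunc p) -> ext false (trunc q) ->
  ole p q = ole (lastedge p) (lastedge q).
Proof.
move=> pe qe; have [E|ne] := eqVneq (lastedge p) (lastedge q).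
  suff -> : p = q by rewrite !ole_refl.
  by apply: (fin_path_inj _ E); apply: (ext_uniq pe qe); rewrite !rng_trunc E.
have := @dle_comp _ _ _ (seg B 0 n) (edge B n) true p q.
by rewrite /dle -/(lastedge p) -/(lastedge q) ne (negbTE ne) orbF.
Qed.

(** The cylinder of [p] lies in that of [trunc p], which is the first cell of its tower because
    [trunc p] is minimal. *)
Lemma tower_edge_exists n (p : fin_path B n.+1) : ext false (trunc p) ->
  exists e : edge (P_obj path_sds) n,
    [/\ src e = tower_vertex (src (lastedge p)),
        rng e = tower_vertex (rng p) & (val e).2 = rank p :> nat].
Proof.
move=> pe; apply: E_tower_at.
- exact: path_top_le.
- by rewrite /= size_path_tower rank_lt.
- move=> x /path_tower_nth[xr xp]; apply/path_tower_nth.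
  have -> : stage x n = trunc p by rewrite -(rank_inj xr xp) stageS.
  by split; [exact: rng_trunc | apply/ext_false_rank].
Qed.

(** The cell at position [k] of the range lies in the first cell of the source, so the path naming
    it has a minimal truncation. *)
Lemma tower_edge_surj n (e : edge (P_obj path_sds) n) :
  exists p : fin_path B n.+1, [/\ ext false (trunc p),
    src e = tower_vertex (src (lastedge p)),
    rng e = tower_vertex (rng p) & (val e).2 = rank p :> nat].
Proof.
case: e => -[[S T] k] ep; have := ep => /asboolP /= [le sub].
have S0 := tower_gt0 (valP S).
have kT : (k < size (val T))%N.
  by apply: leq_trans le; rewrite -addn1 leq_add2l.
have [x Tx] := cell_neq0 (valP T) kT; have := sub 0 S0; rewrite addn0 => /(_ _ Tx).
have [v vS] := path_towersP (valP S); have [w wT] := path_towersP (valP T).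
move: Tx; rewrite vS wT => /path_tower_nth[xw xk] /path_tower_nth[xv x0].
exists (stage x n.+1); rewrite stageS xk; split=> //.
- exact/ext_false_rank.
- by apply: val_inj; rewrite /= -rng_trunc stageS xv.
- by apply: val_inj; rewrite [LHS]wT -xw.
Qed.

Lemma iso_path_sds : obd_iso B (P_obj path_sds).
Proof.
have /dependent_choice[h hP] (n : nat) :
    exists h : edge B n -> edge (P_obj path_sds) n, forall e,
      exists p : fin_path B n.+1, [/\ lastedge p = e, ext false (trunc p),
        src (h e) = tower_vertex (src e), rng (h e) = tower_vertex (rng e)
        & (val (h e)).2 = rank p :> nat].
  apply: (@dependent_choice _ (fun=> edge (P_obj path_sds) n) (fun e he => exists p : fin_path B n.+1,
    [/\ lastedge p = e, ext false (trunc p),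
        src he = tower_vertex (src e), rng he = tower_vertex (rng e)
        & (val he).2 = rank p :> nat])) => e.
  have [p [<- pe]] := min_extension e; have [he [? ? ?]] := tower_edge_exists pe.
  by exists he, p.
apply: (@obd_iso_levelwise _ _ tower_vertex h) => [n|n e'|n e|n e|n e e'].
- exact: tower_vertex_bij.
- have [p [pe ps pr pk]] := tower_edge_surj e'; exists (lastedge p).
  have [q [qp qe qs qr qk]] := hP n (lastedge p).
  (* Both paths are minimal extensions of the same last edge. *)
  have E : p = q.
    by apply: fin_path_inj => //; apply: (ext_uniq pe qe); rewrite !rng_trunc qp.
  (* A tower edge is determined by its source, range and position. *)
  apply: val_inj; move: qs qr qk; rewrite -ps -pr -E -pk.
  rewrite /src /rng /=; case: (val (h n _)) (val e') => [[? ?] ?] [[? ?] ?] /= -> ->.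
  by move=> /val_inj ->.
- by have [p []] := hP n e.
- by have [p []] := hP n e.
- have [p [pe pm _ pr pk]] := hP n e; have [q [qe qm _ qr qk]] := hP n e'.
  rewrite -pe -qe -min_extension_le // [LHS]/= /tower_edge_le pe qe.
  rewrite -[(val (h n e)).1.2]/(rng (h n e)) -[(val (h n e')).1.2]/(rng (h n e')).
  rewrite pr qr pk qk (inj_eq (bij_inj (@tower_vertex_bij _))).
  (* For a common range both orders compare ranks; for different ranges neither relates the
     edges. *)
  have [E|ne] := eqVneq; first by rewrite rank_le // !rng_lastedge pe qe.
  apply/esym/negP => /ole_rng; rewrite !rng_lastedge pe qe => E.
  by rewrite E eqxx in ne.
Qed.

End PathTowers.

Theorem lemma3p9 (R : realType) (B : obd) :
  (exists X : sds R, obd_iso B (P_obj X)) <-> properly_ordered B.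
Proof.
split=> [[X BX]|[Bmax Bmin]].
  have H b : unique_ext_path B b.
    apply: eventually_const_path; apply: eventually_const_iso BX _.
    exact: P_obj_eventually_const.
  by split; [exact: H true | exact: H false].
have po b : unique_ext_path B b by case: b.
exists (path_sds R po); exact: iso_path_sds.
Qed.
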